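(* Fix any $\delta,\gamma>0$. There is an algorithm that, given any $\mathcal{A}=\{u_iu_i^T\}_{i=1}^n$ with real vectors $u_1,\dots,u_n$ (of the same dimension) such that each $\|u_i\|_2=1$ and $|\cos\measuredangle(u_i,u_j)|\ge\gamma$ for all $i,j$, outputs $\hat p\in\Delta_n$ satisfying $$\lambda(\mathcal{A},\hat p)\ \le\ \min_{p\in\Delta_n}\lambda(\mathcal{A},p)+\delta\log\frac1\gamma$$ in time that is polynomial in $n$ and the input size of $\mathcal{A}$ (but not necessarily in $\delta$ or $\gamma$).
   Context: $\Delta_n := \{p \in \mathbb{R}_{\geq 0}^n : \sum_{i=1}^n p_i = 1\}$; $\|\cdot\|_2$ is the Euclidean norm, and $\measuredangle(u_i,u_j)$ is the angle between $u_i$ and $u_j$. For a finite collection $\mathcal{A}=\{A_1,\dots,A_n\}$ of real square matrices of the same size and $p\in\Delta_n$, the Lyapunov exponent is $$\lambda(\mathcal{A},p) := \lim_{k\to\infty} \frac1k\, \mathbb{E} \log \|A_{\sigma_k}\cdots A_{\sigma_2}A_{\sigma_1}\|,$$ where $\sigma_1,\sigma_2,\dots$ are i.i.d. with distribution $p$; it does not depend on the choice of matrix norm. Logarithms are natural. The input size is measured by $n$ and the bit complexity of $\mathcal{A}$. *)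

(* Defs.v *)
From HB Require Import structures.
From mathcomp Require Import all_boot all_order all_algebra.
From mathcomp Require Import all_classical all_reals all_analysis.

Set Implicit Arguments.
Unset Strict Implicit.
Unset Printing Implicit Defensive.

Import Order.TTheory GRing.Theory Num.Theory.
Import numFieldNormedType.Exports.

Local Open Scope classical_set_scope.
Local Open Scope ring_scope.

Definition simplex (R : numDomainType) (n : nat) : set 'rV[R]_n :=
  [set p | (forall i, 0 <= p 0 i) /\ \sum_(i < n) p 0 i = 1].

Section Euclidean.
Context {R : realType} {d : nat}.
Implicit Types u v : 'cV[R]_d.

Definition dot u v : R := \sum_(k < d) u k 0 * v k 0.
Definition norm2 u : R := Num.sqrt (\sum_(k < d) u k 0 ^+ 2).
Definition angle u v : R := acos (dot u v / (norm2 u * norm2 v)).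

End Euclidean.

Section Lyapunov.
Context {R : realType} {n d : nat}.
Variables (A : 'I_n -> 'M[R]_d) (p : 'rV[R]_n).

(* A word w is (sigma_1, ..., sigma_k), so the product below is
   A_{sigma_k} *m ... *m A_{sigma_1}. *)
Definition word_prod (k : nat) (w : k.-tuple 'I_n) : 'M[R]_d :=
  \big[mulmx/1%:M]_(i <- rev w) A i.

(* The expectation is the finite sum over all words of length k, each weighted
   by its probability under the product distribution. `|M| is the library norm
   on matrices (maximum of the absolute values of the entries). The value is
   extended real because lne 0 = -oo; words of probability 0 contribute 0,
   since 0 * -oo = 0. *)
Definition expected_log_norm (k : nat) : \bar R :=
  (\sum_(w : k.-tuple 'I_n)
     (\prod_(i <- w) p 0 i)%:E * lne (`|word_prod w|%:E))%E.

Definition lyapunov : \bar R :=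
  limn (fun k : nat => ((k%:R^-1)%:E * expected_log_norm k)%E).

End Lyapunov.

Definition is_minimum d (T : porderType d) (S : set T) (x : T) : Prop :=
  S x /\ lbound S x.

(* Algorithms are structured programs for a random access machine with indirect
   addressing whose cells hold integers of arbitrary size. Running time is
   measured by the logarithmic cost criterion: every operand, address and stored
   value is charged its number of bits, and a multiplication is charged the
   product of the bit lengths of its operands. This time measure is polynomially
   equivalent to that of multitape Turing machines. *)
Definition memory := int -> int.

Definition bitsize (z : int) : nat := (trunc_log 2 `|z|%N).+1.

Inductive expr : Type :=
| Const of int
| Fetch of expr
| Add of expr & expr
| Sub of expr & expr
| Mul of expr & expr.

Fixpoint eval (m : memory) (e : expr) : int :=
  match e with
  | Const z => z
  | Fetch a => m (eval m a)
  | Add e1 e2 => eval m e1 + eval m e2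
  | Sub e1 e2 => eval m e1 - eval m e2
  | Mul e1 e2 => eval m e1 * eval m e2
  end.

Fixpoint cost (m : memory) (e : expr) : nat :=
  match e with
  | Const z => bitsize z
  | Fetch a => cost m a + bitsize (eval m a) + bitsize (m (eval m a))
  | Add e1 e2 | Sub e1 e2 =>
      cost m e1 + cost m e2 + bitsize (eval m e1) + bitsize (eval m e2)
  | Mul e1 e2 =>
      cost m e1 + cost m e2 + bitsize (eval m e1) * bitsize (eval m e2)
  end%N.

(* Store a e writes the value of e to the cell whose address is the value of a;
   the tests of If and While succeed when the value is positive. *)
Inductive prog : Type :=
| Skip
| Store of expr & expr
| Seq of prog & prog
| If of expr & prog & prog
| While of expr & prog.

(* exec c m t m': started in memory m, program c halts after time t in m'. *)
Inductive exec : prog -> memory -> nat -> memory -> Prop :=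
| ExecSkip m : exec Skip m 1 m
| ExecStore a e m :
    exec (Store a e) m
      (1 + cost m a + cost m e + bitsize (eval m a) + bitsize (eval m e))
      [eta m with eval m a |-> eval m e]
| ExecSeq c1 c2 m1 t1 m2 t2 m3 :
    exec c1 m1 t1 m2 -> exec c2 m2 t2 m3 ->
    exec (Seq c1 c2) m1 (t1 + t2) m3
| ExecIfTrue e c1 c2 m t m' :
    0 < eval m e -> exec c1 m t m' ->
    exec (If e c1 c2) m (1 + cost m e + bitsize (eval m e) + t) m'
| ExecIfFalse e c1 c2 m t m' :
    eval m e <= 0 -> exec c2 m t m' ->
    exec (If e c1 c2) m (1 + cost m e + bitsize (eval m e) + t) m'
| ExecWhileTrue e c m1 t1 m2 t2 m3 :
    0 < eval m1 e -> exec c m1 t1 m2 -> exec (While e c) m2 t2 m3 ->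
    exec (While e c) m1 (1 + cost m1 e + bitsize (eval m1 e) + t1 + t2) m3
| ExecWhileFalse e c m :
    eval m e <= 0 -> exec (While e c) m (1 + cost m e + bitsize (eval m e)) m.

Section Encoding.
Variables (n d : nat) (A : 'I_n -> 'M[rat]_d).

Definition encode_rat (q : rat) : seq int := [:: numq q; denq q].

(* n, then d, then the entries of A_1, ..., A_n in row-major order, each as a
   numerator followed by a denominator. *)
Definition encode_input : seq int :=
  n%:Z :: d%:Z ::
  flatten [seq flatten [seq encode_rat (A i r s) | r <- enum 'I_d, s <- enum 'I_d]
          | i <- enum 'I_n].

Definition bit_complexity : nat :=
  (\sum_(i < n) \sum_(r < d) \sum_(s < d)
     (bitsize (numq (A i r s)) + bitsize (denq (A i r s))))%N.

End Encoding.

(* The list s is placed in cells 0, 1, 2, ...; all other cells hold 0. *)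
Definition init_mem (s : seq int) : memory :=
  fun a => if a is Posz k then nth 0 s k else 0.

(* Cells 2i and 2i + 1 hold a numerator and a positive denominator of q_i; the
   fraction need not be reduced. *)
Definition outputs (n : nat) (m : memory) (q : 'rV[rat]_n) : Prop :=
  forall i : 'I_n,
    0 < m (2 * i + 1)%N%:Z /\
    q 0 i = (m (2 * i)%N%:Z)%:~R / (m (2 * i + 1)%N%:Z)%:~R.

(* Main.v *)
Require Import Defs.
From HB Require Import structures.
From mathcomp Require Import all_boot all_order all_algebra.
From mathcomp Require Import all_classical all_reals all_analysis.
From mathcomp Require Import zify ring lra.

(** A product of rank one matrices [u_i u_i^T] telescopes into a scalar multiple
    of [u_last u_first^T], the scalar being the product of the inner products of
    consecutive letters. The two end letters have a bounded effect on the
    logarithm of the norm, so the Lyapunov exponent is the quadratic form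
    [energy p = sum_ij p_i p_j ln |u_i . u_j|] ([lyapunov_rank1]), which is
    continuous and attains its minimum on the simplex ([energy_minimum]).

    The quadratic form is minimised approximately by exhaustive search over the
    letter frequencies of words of length [k], where [k >= 1 / delta] is fixed.
    Draw the [k] letters of a word independently from a minimiser [p]. Distinct
    positions are independent, and equal positions contribute [ln 1 = 0], so the
    frequencies of the random word have mean energy [(1 - 1/k) energy p]. The
    best word does at least as well, and [energy p >= ln gamma] bounds the loss
    by [(1/k) ln (1/gamma)] ([energy_best_word]).

    The search needs no logarithms and no rounding: [(u_i . u_j)^2] is the
    rational number [tr (A_i A_j)], and the energy of the frequencies of a word
    is an increasing function of the product of these traces over all pairs of
    positions ([ratr_prod_trace_mul]). The program compares these products as
    unreduced fractions by cross multiplication, through [k] nested loops.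

    For the running time, each program has a bound [time_bound], computed from
    its syntax alone and polynomial in a number [L] that bounds both the length
    of every stored integer and the number of iterations of every loop.
    The triple [runs] combines total correctness, this time bound and the
    preservation of the bound on the stored integers. The search runs with [L]
    polynomial in the size of the input ([best_word_algorithm]). *)

Set Implicit Arguments.
Unset Strict Implicit.
Unset Printing Implicit Defensive.

Import Order.TTheory GRing.Theory Num.Theory.
Import numFieldNormedType.Exports.

Local Open Scope classical_set_scope.
Local Open Scope ring_scope.

Local Notation eval := Defs.eval.
Local Notation Sub := Defs.Sub.

(** * Running time of programs on bounded memories *)

Section BitLengths.
Implicit Types (L : nat) (z x y : int).

Definition fits L z : bool := (`|z|%N < 2 ^ L)%N.

Lemma fits_bitsize z : fits (bitsize z) z.
Proof. by rewrite /fits trunc_log_ltn. Qed.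

Lemma bitsize_fits L z : (0 < L)%N -> fits L z -> (bitsize z <= L)%N.
Proof.
rewrite /fits /bitsize => L_gt0; have [->|z_neq0] := eqVneq z 0.
  by rewrite trunc_log0.
move=> zL; rewrite -(ltn_exp2l _ _ (isT : (1 < 2)%N)).
by apply: leq_ltn_trans zL; rewrite trunc_logP // absz_gt0.
Qed.

Lemma fits_leq L L' z : (L <= L')%N -> fits L z -> fits L' z.
Proof. by rewrite /fits => LL' zL; apply: leq_trans zL _; rewrite leq_exp2l. Qed.

Lemma fitsM L L' x y : fits L x -> fits L' y -> fits (L + L') (x * y).
Proof. by rewrite /fits abszM expnD => xL yL; rewrite ltn_mul. Qed.

Lemma fitsD L L' x y : (0 < L)%N -> (0 < L')%N ->
  fits L x -> fits L' y -> fits (L + L') (x + y).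
Proof.
rewrite /fits expnD => L0 L'0 xL yL'.
have := leq_pexp2l (isT : (0 < 2)%N) L0.
have := leq_pexp2l (isT : (0 < 2)%N) L'0.
set a := (2 ^ L)%N in xL *; set b := (2 ^ L')%N in yL' *.
rewrite expn1 => b2 a2; have xy : (`|(x + y)%R| <= `|x| + `|y|)%N by lia.
by apply: leq_ltn_trans xy _; nia.
Qed.

Lemma fitsB L L' x y : (0 < L)%N -> (0 < L')%N ->
  fits L x -> fits L' y -> fits (L + L') (x - y).
Proof. by move=> L0 L'0 xL yL'; rewrite fitsD // /fits abszN. Qed.

End BitLengths.

Definition bounded (L : nat) (m : memory) : Prop := forall a, fits L (m a).

(** Length of the value of an expression, in units of the bound on the length
    of the cells; the unit of [effort] is the square of that bound. *)
Fixpoint width (e : expr) : nat :=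
  match e with
  | Const z => bitsize z
  | Fetch _ => 1
  | Add e1 e2 | Sub e1 e2 | Mul e1 e2 => width e1 + width e2
  end.

Fixpoint effort (e : expr) : nat :=
  match e with
  | Const z => bitsize z
  | Fetch a => effort a + width a + 1
  | Add e1 e2 | Sub e1 e2 => effort e1 + effort e2 + width e1 + width e2
  | Mul e1 e2 => effort e1 + effort e2 + width e1 * width e2
  end.

Lemma width_gt0 e : (0 < width e)%N.
Proof. by elim: e => //= e1 H1 e2 H2; rewrite addn_gt0 H1. Qed.

(** The single variable bounds both the length of every cell and the number of
    iterations of every loop, so that the bound depends on the syntax only. *)
Fixpoint time_bound (c : prog) : {poly nat} :=
  match c with
  | Skip => 1
  | Store a e =>
      ((1 + effort a + effort e + width a + width e)%N)%:P * 'X^2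
  | Seq c1 c2 => time_bound c1 + time_bound c2
  | If e c1 c2 =>
      ((1 + effort e + width e)%N)%:P * 'X^2 + time_bound c1 + time_bound c2
  | While e c =>
      ('X + 1) * (((1 + effort e + width e)%N)%:P * 'X^2)
      + 'X * time_bound c
  end.

(** Termination, the time bound and the bound on the cells depend on one another
    through the values of the loop counters, so they are established together. *)
Definition runs (L : nat) (c : prog) (m : memory) (Q : memory -> Prop) : Prop :=
  exists t m', [/\ exec c m t m', (t <= (time_bound c).[L])%N,
                   bounded L m' & Q m'].

Definition upd (m : memory) (a x : int) : memory := [eta m with a |-> x].

Lemma updE m a x b : upd m a x b = if b == a then x else m b.
Proof. by []. Qed.

Section Rules.
Variable L : nat.
Hypothesis L_gt0 : (0 < L)%N.

Lemma fits_eval m e : bounded L m -> fits (width e * L) (eval m e).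
Proof.
move=> mL; elim: e => [z|a _|e1 H1 e2 H2|e1 H1 e2 H2|e1 H1 e2 H2] /=.
- by apply: fits_leq (fits_bitsize z); rewrite leq_pmulr.
- by rewrite mul1n.
- by rewrite mulnDl fitsD // muln_gt0 width_gt0.
- by rewrite mulnDl fitsB // muln_gt0 width_gt0.
- by rewrite mulnDl fitsM.
Qed.

Lemma bitsize_eval m e : bounded L m -> (bitsize (eval m e) <= width e * L)%N.
Proof.
by move=> mL; apply: bitsize_fits; [rewrite muln_gt0 width_gt0 | apply: fits_eval].
Qed.

Lemma cost_effort m e : bounded L m -> (cost m e <= effort e * L ^ 2)%N.
Proof.
move=> mL; have LL : (L <= L ^ 2)%N by rewrite expnS expn1 leq_pmulr.
have bound w : (w * L <= w * L ^ 2)%N by rewrite leq_mul2l LL orbT.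
elim: e => [z|a H|e1 H1 e2 H2|e1 H1 e2 H2|e1 H1 e2 H2] /=.
- by rewrite leq_pmulr // expn_gt0 L_gt0.
- rewrite !mulnDl mul1n !leq_add //.
    exact: leq_trans (bitsize_eval a mL) (bound _).
  exact: leq_trans (bitsize_fits L_gt0 (mL _)) LL.
- rewrite !mulnDl !leq_add //.
    exact: leq_trans (bitsize_eval e1 mL) (bound _).
  exact: leq_trans (bitsize_eval e2 mL) (bound _).
- rewrite !mulnDl !leq_add //.
    exact: leq_trans (bitsize_eval e1 mL) (bound _).
  exact: leq_trans (bitsize_eval e2 mL) (bound _).
- rewrite !mulnDl !leq_add // -mulnn mulnACA.
  by rewrite leq_mul ?bitsize_eval.
Qed.

Lemma guard_cost m e : bounded L m ->
  (1 + cost m e + bitsize (eval m e) <=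
     (((1 + effort e + width e)%N)%:P * 'X^2 : {poly nat}).[L])%N.
Proof.
move=> mL; rewrite hornerM hornerC hornerXn.
have -> : (L ^+ 2)%R = (L ^ 2)%N by [].
change ((1 + cost m e + bitsize (eval m e) <= (1 + effort e + width e) * L ^ 2)%N).
have H1 := cost_effort e mL; have H2 := bitsize_eval e mL.
have LL : (L <= L ^ 2)%N by rewrite expnS expn1 leq_pmulr.
have H3 : (1 <= L ^ 2)%N by rewrite expn_gt0 L_gt0.
have H4 : (width e * L <= width e * L ^ 2)%N by rewrite leq_mul2l LL orbT.
by lia.
Qed.

Lemma runs_weaken c m (Q Q' : memory -> Prop) :
  runs L c m Q -> (forall m', bounded L m' -> Q m' -> Q' m') -> runs L c m Q'.
Proof.
by move=> [t [m' [cm tL m'L Qm']]] QQ'; exists t, m'; split=> //; apply: QQ'.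
Qed.

Lemma runs_skip m (Q : memory -> Prop) : bounded L m -> Q m -> runs L Skip m Q.
Proof.
by move=> mL Qm; exists 1%N, m; split=> //; [constructor|rewrite hornerC].
Qed.

Lemma runs_store a e m (Q : memory -> Prop) :
  bounded L m -> fits L (eval m e) ->
  (bounded L (upd m (eval m a) (eval m e)) -> Q (upd m (eval m a) (eval m e))) ->
  runs L (Store a e) m Q.
Proof.
move=> mL eL Qm.
have m'L : bounded L (upd m (eval m a) (eval m e)).
  by move=> b; rewrite updE; case: ifP.
exists (1 + cost m a + cost m e + bitsize (eval m a) + bitsize (eval m e))%N.
exists (upd m (eval m a) (eval m e)); split=> //; last exact: Qm.
- exact: ExecStore.
- rewrite /= hornerM hornerC hornerXn.
  have -> : (L ^+ 2)%R = (L ^ 2)%N by [].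
  change ((1 + cost m a + cost m e + bitsize (eval m a) + bitsize (eval m e)
    <= (1 + effort a + effort e + width a + width e) * L ^ 2)%N).
  have H1 := cost_effort e mL; have H2 := bitsize_eval e mL.
  have H1' := cost_effort a mL; have H2' := bitsize_eval a mL.
  have LL : (L <= L ^ 2)%N by rewrite expnS expn1 leq_pmulr.
  have H3 : (1 <= L ^ 2)%N by rewrite expn_gt0 L_gt0.
  have H4 w : (w * L <= w * L ^ 2)%N by rewrite leq_mul2l LL orbT.
  by have := H4 (width a); have := H4 (width e); lia.
Qed.

Lemma runs_seq c1 c2 m (Q : memory -> Prop) :
  runs L c1 m (fun m' => runs L c2 m' Q) -> runs L (Seq c1 c2) m Q.
Proof.
move=> [t1 [m1 [ex1 t1L _ [t2 [m2 [ex2 t2L m2L Qm2]]]]]].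
exists (t1 + t2)%N, m2; split=> //; first exact: ExecSeq ex1 ex2.
by rewrite /= hornerD leq_add.
Qed.

Lemma runs_if e c1 c2 m (Q : memory -> Prop) : bounded L m ->
  (0 < eval m e -> runs L c1 m Q) -> (eval m e <= 0 -> runs L c2 m Q) ->
  runs L (If e c1 c2) m Q.
Proof.
move=> mL run1 run2; have gL := guard_cost e mL.
case: (ltP 0 (eval m e)) => [e_gt0|e_le0].
  have [t [m' [ex tL m'L Qm']]] := run1 e_gt0.
  exists (1 + cost m e + bitsize (eval m e) + t)%N, m'; split=> //.
    exact: ExecIfTrue.
  by rewrite /= 2!hornerD; apply: leq_trans (leq_add gL tL) (leq_addr _ _).
have [t [m' [ex tL m'L Qm']]] := run2 e_le0.
exists (1 + cost m e + bitsize (eval m e) + t)%N, m'; split=> //.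
  exact: ExecIfFalse.
rewrite /= 2!hornerD; apply: leq_trans (leq_add gL tL) _.
by apply: leq_add => //; apply: leq_addr.
Qed.

(** The invariant is indexed by the number of iterations already performed. *)
Lemma runs_while e c m J (Inv : nat -> memory -> Prop) (Q : memory -> Prop) :
  (J <= L)%N -> bounded L m -> Inv 0%N m ->
  (forall i m', (i < J)%N -> bounded L m' -> Inv i m' ->
     0 < eval m' e /\ runs L c m' (Inv i.+1)) ->
  (forall m', bounded L m' -> Inv J m' -> eval m' e <= 0 /\ Q m') ->
  runs L (While e c) m Q.
Proof.
move=> JL mL Inv0 step final.
pose g := (((1 + effort e + width e)%N)%:P * 'X^2 : {poly nat}).[L].
pose b := (time_bound c).[L].
suff [t [m' [ex tL m'L Qm']]] : exists t m',
    [/\ exec (While e c) m t m', (t <= J.+1 * g + J * b)%N, bounded L m' & Q m'].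
  exists t, m'; split=> //; apply: leq_trans tL _.
  have -> : (time_bound (While e c)).[L] = ((L + 1) * g + L * b)%N.
    rewrite /= hornerD [(('X + 1) * _).[_]]hornerM [('X * _).[_]]hornerM.
    by rewrite hornerD hornerX hornerC.
  by rewrite addn1 leq_add // leq_mul2r ?ltnS JL orbT.
have : (0 + J)%N = J by [].
elim: {1 3 4}J 0%N m mL Inv0 => [|r IHr] i m mL Invi ir.
  have [e_le0 Qm] := final m mL (ltac:(by move: Invi; rewrite -ir addn0)).
  exists (1 + cost m e + bitsize (eval m e))%N, m; split=> //.
    exact: ExecWhileFalse.
  by rewrite mul1n mul0n addn0 guard_cost.
have iJ : (i < J)%N by lia.
have [e_gt0 [t1 [m1 [ex1 t1L m1L Inv1]]]] := step i m iJ mL Invi.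
have [t2 [m2 [ex2 t2L m2L Qm2]]] := IHr i.+1 m1 m1L Inv1 (ltac:(lia)).
exists (1 + cost m e + bitsize (eval m e) + t1 + t2)%N, m2; split=> //.
  exact: ExecWhileTrue ex1 ex2.
have gL := guard_cost e mL; rewrite -/g in gL; rewrite -/b in t1L.
rewrite mulSn [(r.+1 * b)%N]mulSn addnACA.
by apply: leq_add t2L; apply: leq_add.
Qed.

End Rules.
(** * The search program *)

(** The trace being summed is the fraction [vX / vY], with index [vT]; the value
    of the current word is [vP / vQ], and that of the best word is [vBP / vBQ]. *)
Local Notation vN := 0%N (only parsing).
Local Notation vD := 1%N (only parsing).
Local Notation vT := 2%N (only parsing).
Local Notation vX := 3%N (only parsing).
Local Notation vY := 4%N (only parsing).
Local Notation vP := 5%N (only parsing).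
Local Notation vQ := 6%N (only parsing).
Local Notation vBP := 7%N (only parsing).
Local Notation vBQ := 8%N (only parsing).

(** The two words are interleaved, which leaves room for any word length. *)
Definition vW (j : nat) : nat := (9 + 2 * j)%N.
Definition vBW (j : nat) : nat := (10 + 2 * j)%N.

(** The input and the output occupy the cells of nonnegative address, so the
    variables of the program live at the negative addresses. *)
Definition var (v : nat) : expr := Const (Negz v).
Definition read (v : nat) : expr := Fetch (var v).
Definition assign (v : nat) (e : expr) : prog := Store (var v) e.

Definition sequence (I : Type) (f : I -> prog) (s : seq I) : prog :=
  foldr (fun i c => Seq (f i) c) Skip s.

Definition entry_cell (c a : nat) : expr :=
  Fetch (Add (Const c%:Z)
    (Mul (Const 2) (Add (Mul (read (vW a)) (read vD)) (read vT)))).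

Definition num a := entry_cell 2 a.
Definition den a := entry_cell 3 a.

(** Fractions are added without reduction: over a whole trace the lengths grow
    only linearly in the number of terms. *)
Definition trace_step (a b : nat) : prog :=
  Seq (assign vX (Add (Mul (read vX) (Mul (den a) (den b)))
                   (Mul (read vY) (Mul (num a) (num b)))))
 (Seq (assign vY (Mul (read vY) (Mul (den a) (den b))))
      (assign vT (Add (read vT) (Const 1)))).

Definition multiply_trace (ab : nat * nat) : prog :=
  Seq (assign vX (Const 0))
 (Seq (assign vY (Const 1))
 (Seq (assign vT (Const 0))
 (Seq (While (Sub (read vD) (read vT)) (trace_step ab.1 ab.2))
 (Seq (assign vP (Mul (read vP) (read vX)))
      (assign vQ (Mul (read vQ) (read vY))))))).

Definition index_pairs (k : nat) : seq (nat * nat) :=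
  [seq (a, b) | a <- iota 0 k, b <- iota 0 k].

Definition evaluate (k : nat) : prog :=
  Seq (assign vP (Const 1)) (Seq (assign vQ (Const 1))
    (sequence multiply_trace (index_pairs k))).

Definition save_word (k : nat) : prog :=
  sequence (fun j => assign (vBW j) (read (vW j))) (iota 0 k).

(** The denominators stay positive, so that cross multiplication decides the
    comparison of the two values. *)
Definition challenge (k : nat) : prog :=
  Seq (evaluate k)
    (If (Sub (Mul (read vBP) (read vQ)) (Mul (read vP) (read vBQ)))
        (Seq (assign vBP (read vP)) (Seq (assign vBQ (read vQ)) (save_word k)))
        Skip).

(** The word length is a constant of the program, so the enumeration of all words
    can be written as that many nested loops; [search k r] is the part of the
    nest that varies the letters of index below [r]. *)
Fixpoint search (k r : nat) : prog :=
  if r is r'.+1 then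
    Seq (assign (vW r') (Const 0))
      (While (Sub (read vN) (read (vW r')))
        (Seq (search k r') (assign (vW r') (Add (read (vW r')) (Const 1)))))
  else challenge k.

Definition num_out (e : expr) : expr := Mul (Const 2) e.
Definition den_out (e : expr) : expr := Add (Mul (Const 2) e) (Const 1).

Definition clear_step (k : nat) : prog :=
  Seq (Store (num_out (read vT)) (Const 0))
 (Seq (Store (den_out (read vT)) (Const k%:Z))
      (assign vT (Add (read vT) (Const 1)))).

Definition count_letter (j : nat) : prog :=
  Store (num_out (read (vBW j))) (Add (Fetch (num_out (read (vBW j)))) (Const 1)).

Definition write_frequencies (k : nat) : prog :=
  Seq (assign vT (Const 0))
 (Seq (While (Sub (read vN) (read vT)) (clear_step k))
      (sequence count_letter (iota 0 k))).

(** The search starts from the constant word [0]: fresh cells hold [0], and the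
    value of this word is [1] because it only involves traces [tr (A_0 A_0)]. *)
Definition best_word_program (k : nat) : prog :=
  Seq (assign vN (Fetch (Const 0)))
 (Seq (assign vD (Mul (Fetch (Const 1)) (Fetch (Const 1))))
 (Seq (assign vBP (Const 1))
 (Seq (assign vBQ (Const 1))
 (Seq (search k k) (write_frequencies k))))).

Section Correctness.
Variables (k n D B L : nat) (E : nat -> rat).

Definition correlation (i j : nat) : rat :=
  \sum_(t < D) E (i * D + t) * E (j * D + t).

Definition word_value (w : nat -> nat) : rat :=
  \prod_(ab <- index_pairs k) correlation (w ab.1) (w ab.2).

Definition valid_word (w : nat -> nat) : Prop := forall j, (j < k)%N -> (w j < n)%N.

Record searching (m : memory) (w bw : nat -> nat) : Prop := Searching {
  entry_num : forall t, (t < n * D)%N -> m (2 + 2 * t)%N%:Z = numq (E t);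
  entry_den : forall t, (t < n * D)%N -> m (3 + 2 * t)%N%:Z = denq (E t);
  stored_n : m (Negz vN) = n;
  stored_D : m (Negz vD) = D;
  current_word : forall j, (j < k)%N -> m (Negz (vW j)) = w j;
  best_word : forall j, (j < k)%N -> m (Negz (vBW j)) = bw j;
  best_den_gt0 : 0 < m (Negz vBQ);
  best_value : (m (Negz vBP))%:~R / (m (Negz vBQ))%:~R = word_value bw;
  best_valid : valid_word bw }.

Hypothesis n_gt0 : (0 < n)%N.
Hypothesis leDB : (D <= B)%N.
Hypothesis lenB : (n <= B)%N.
Hypothesis ltBL : (B < L)%N.
Hypothesis ltkL : (k < L)%N.
Hypothesis fits_num : forall t, fits B (numq (E t)).
Hypothesis fits_den : forall t, fits B (denq (E t)).

Definition step_bits := (2 * B + 1)%N.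
Definition trace_bits := (step_bits * B)%N.
Hypothesis ltvalueL : (size (index_pairs k) * trace_bits < L)%N.

Let L_gt0 : (0 < L)%N. Proof. exact: leq_ltn_trans ltBL. Qed.
Let L_gt1 : (1 < L)%N.
Proof. exact: leq_ltn_trans (leq_trans n_gt0 lenB) ltBL. Qed.

Definition below (e : nat) (z : int) : bool := (`|z|%N <= 2 ^ e)%N.

Lemma below_fits e z : (e < L)%N -> below e z -> fits L z.
Proof. by move=> eL ze; apply: leq_ltn_trans ze _; rewrite ltn_exp2l. Qed.

Lemma fits_below e z : fits e z -> below e z.
Proof. exact: ltnW. Qed.

Lemma belowM e f x y : below e x -> below f y -> below (e + f) (x * y).
Proof. by rewrite /below abszM expnD => xe yf; rewrite leq_mul. Qed.

Lemma belowD e x y : below e x -> below e y -> below (e + 1) (x + y).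
Proof. by rewrite /below addn1 expnS => xe ye; lia. Qed.

Lemma below_leq e f z : (e <= f)%N -> below e z -> below f z.
Proof. by move=> ef ze; apply: leq_trans ze _; rewrite leq_exp2l. Qed.

Lemma fits_small (x : nat) : (x < L)%N -> fits L x%:Z.
Proof. by move=> xL; apply: ltn_trans xL _; apply: ltn_expl. Qed.

(** The cells that hold the current sum, the current product and the loop index
    are scratch space for the search. *)
Lemma searching_upd m w bw v x : (1 < v < 7)%N ->
  searching m w bw -> searching (upd m (Negz v) x) w bw.
Proof.
move=> v_scratch [mn md mN mD mw mbw q0 val vbw].
have out u : (u < 2)%N || (6 < u)%N -> upd m (Negz v) x (Negz u) = m (Negz u).
  by move=> uv; rewrite updE; case: eqP => // -[uv']; exfalso; lia.
have w_out j : upd m (Negz v) x (Negz (vW j)) = m (Negz (vW j)).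
  by rewrite out // /vW; lia.
have bw_out j : upd m (Negz v) x (Negz (vBW j)) = m (Negz (vBW j)).
  by rewrite out // /vBW; lia.
have pos_out (c : nat) : upd m (Negz v) x c%:Z = m c%:Z by [].
by split=> [t|t|||j|j|||]; rewrite ?pos_out ?w_out ?bw_out ?out //; auto.
Qed.

Lemma eval_entry m w bw c a t : searching m w bw -> (a < k)%N -> (w a < n)%N ->
  m (Negz vT) = t%:Z ->
  eval m (entry_cell c a) = m (c + 2 * (w a * D + t))%N%:Z.
Proof.
by move=> sm ak wan mt; rewrite /= (current_word sm ak) (stored_D sm) mt; congr m; lia.
Qed.

Lemma entry_index i t : (i < n)%N -> (t < D)%N -> (i * D + t < n * D)%N.
Proof.
move=> i_n tD; apply: (@leq_trans (i.+1 * D)); last by rewrite leq_mul2r i_n orbT.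
by rewrite mulSn addnC ltn_add2r.
Qed.

Section Trace.
Variables (w bw : nat -> nat) (a b : nat).
Hypotheses (ak : (a < k)%N) (bk : (b < k)%N).
Hypotheses (wan : (w a < n)%N) (wbn : (w b < n)%N).

Record summing (p q : int) (t : nat) (m : memory) : Prop := Summing {
  sum_searching : searching m w bw;
  sum_T : m (Negz vT) = t;
  sum_P : m (Negz vP) = p;
  sum_Q : m (Negz vQ) = q;
  sum_den : 0 < m (Negz vY);
  sum_num : (m (Negz vX))%:~R =
    (m (Negz vY))%:~R * \sum_(s < t) E (w a * D + s) * E (w b * D + s);
  sum_belowX : below (step_bits * t) (m (Negz vX));
  sum_belowY : below (step_bits * t) (m (Negz vY)) }.

Lemma runs_trace_step p q t m : (t < D)%N -> bounded L m -> summing p q t m ->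
  runs L (trace_step a b) m (summing p q t.+1).
Proof.
move=> tD mL [sm mT mP mQ y0 xE bX bY].
have ti := entry_index wan tD; have tj := entry_index wbn tD.
set ei := E (w a * D + t); set ej := E (w b * D + t).
have na m' : searching m' w bw -> m' (Negz vT) = t ->
    eval m' (num a) = numq ei /\ eval m' (den a) = denq ei.
  move=> sm' mt'; rewrite !(eval_entry _ sm' ak wan mt').
  by rewrite (entry_num sm' ti) (entry_den sm' ti).
have nb m' : searching m' w bw -> m' (Negz vT) = t ->
    eval m' (num b) = numq ej /\ eval m' (den b) = denq ej.
  move=> sm' mt'; rewrite !(eval_entry _ sm' bk wbn mt').
  by rewrite (entry_num sm' tj) (entry_den sm' tj).
set x := m (Negz vX) in xE bX; set y := m (Negz vY) in y0 xE bY.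
pose x' := x * (denq ei * denq ej) + y * (numq ei * numq ej).
pose y' := y * (denq ei * denq ej).
(* A term has length [2 * B]; the extra bit absorbs the carry of the sum. *)
have stepE : (step_bits * t.+1 = (step_bits * t + (B + B)) + 1)%N.
  by rewrite /step_bits mulnS; lia.
have bden : below (B + B) (denq ei * denq ej).
  by apply: belowM; apply: fits_below; apply: fits_den.
have bnum : below (B + B) (numq ei * numq ej).
  by apply: belowM; apply: fits_below; apply: fits_num.
have bX' : below (step_bits * t.+1) x'.
  by rewrite stepE belowD // belowM.
have bY' : below (step_bits * t.+1) y'.
  by rewrite stepE; apply: below_leq (leq_addr _ _) _; apply: belowM.
have tL : (step_bits * t.+1 < L)%N.
  apply: leq_ltn_trans (ltvalueL); rewrite /trace_bits.
  apply: (@leq_trans (step_bits * B)); first by rewrite leq_mul2l (leq_trans tD) ?orbT.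
  rewrite leq_pmull // size_allpairs size_iota muln_gt0.
  by have -> : (0 < k)%N by apply: leq_ltn_trans ak.
have [na1 da1] := na m sm mT; have [nb1 db1] := nb m sm mT.
apply: runs_seq; apply: runs_store => //.
  have -> : eval m (Add (Mul (read vX) (Mul (den a) (den b)))
                   (Mul (read vY) (Mul (num a) (num b)))) = x'.
    by move: na1 da1 nb1 db1 => /= -> -> -> ->.
  exact: below_fits bX'.
have -> : eval m (Add (Mul (read vX) (Mul (den a) (den b)))
                   (Mul (read vY) (Mul (num a) (num b)))) = x'.
  by move: na1 da1 nb1 db1 => /= -> -> -> ->.
move=> m1L; set m1 := upd _ _ _ in m1L *.
have sm1 : searching m1 w bw by apply: searching_upd.
have mT1 : m1 (Negz vT) = t by [].
have [na2 da2] := na m1 sm1 mT1; have [nb2 db2] := nb m1 sm1 mT1.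
have yE : eval m1 (Mul (read vY) (Mul (den a) (den b))) = y'.
  by move: da2 db2 => /= -> ->.
apply: runs_seq; apply: runs_store => //; rewrite yE; first exact: below_fits bY'.
move=> m2L; set m2 := upd _ _ _ in m2L *.
have sm2 : searching m2 w bw by apply: searching_upd.
have tE : eval m2 (Add (read vT) (Const 1)) = t.+1.
  by rewrite -[LHS]/(m (Negz vT) + 1) mT -addn1.
apply: runs_store => //; rewrite tE.
  by apply: fits_small; apply: leq_ltn_trans ltBL; apply: leq_trans tD _.
move=> m3L; split=> //; first exact: searching_upd.
- by rewrite /upd /= /y' mulr_gt0 // mulr_gt0 // denq_gt0.
- rewrite /upd /= big_ord_recr /= -/ei -/ej /x' /y' !(rmorphD, rmorphM) /= xE.
  rewrite -[X in _ = _ * (_ + X * _)](divq_num_den ei).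
  rewrite -[X in _ = _ * (_ + _ * X)](divq_num_den ej).
  by field; rewrite !intr_eq0 !denq_neq0.
Qed.

(** Each product adds [trace_bits] to the length of the current value, whence
    the budget [e] for what has been accumulated before. *)
Lemma runs_multiply_trace e m : (e + trace_bits < L)%N -> bounded L m ->
  searching m w bw -> below e (m (Negz vP)) -> below e (m (Negz vQ)) ->
  runs L (multiply_trace (a, b)) m (fun m' => searching m' w bw /\
    exists x y : int, [/\ 0 < y, x%:~R / y%:~R = correlation (w a) (w b),
      below trace_bits x /\ below trace_bits y,
      m' (Negz vP) = m (Negz vP) * x & m' (Negz vQ) = m (Negz vQ) * y]).
Proof.
move=> eL mL sm bP bQ.
apply: runs_seq; apply: runs_store => // [|m1L]; first exact: (fits_small L_gt0).
apply: runs_seq; apply: runs_store => // [|m2L]; first exact: (fits_small L_gt1).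
apply: runs_seq; apply: runs_store => // [|m3L]; first exact: (fits_small L_gt0).
apply: runs_seq.
set m3 := upd _ _ _ in m3L *.
have sm3 : searching m3 w bw by do 3![apply: searching_upd => //].
apply: (runs_while (J := D) L_gt0 (Inv := summing (m (Negz vP)) (m (Negz vQ)))) => //.
- by apply: leq_trans (leq_trans leDB (ltnW ltBL)).
- by split=> //; rewrite ?muln0 // big_ord0 mulr0.
- move=> t m' tD m'L summ; split; last exact: runs_trace_step.
  by rewrite /= (stored_D (sum_searching summ)) (sum_T summ) subr_gt0 ltz_nat.
move=> m4 m4L [sm4 mT mP mQ y0 xE bX bY]; split.
  by rewrite /= (stored_D sm4) mT subrr.
have DB : (step_bits * D <= trace_bits)%N by rewrite leq_mul2l leDB orbT.
have bX' := below_leq DB bX; have bY' := below_leq DB bY.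
apply: runs_seq; apply: runs_store => // [|m5L].
  by apply: below_fits eL _; rewrite /= mP belowM.
apply: runs_store => // [|m6L].
  by apply: below_fits eL _; rewrite -[eval _ _]/(m4 (Negz vQ) * m4 (Negz vY)) mQ belowM.
split; first by do 2![apply: searching_upd => //].
exists (m4 (Negz vX)), (m4 (Negz vY)); split=> //.
- by rewrite xE mulrAC mulfV ?mul1r // intr_eq0 gt_eqF.
- by rewrite /upd /= mP.
- by rewrite /upd /= mQ.
Qed.
End Trace.

Lemma runs_evaluate m w bw : (forall j, (j < k)%N -> (w j < n)%N) ->
  bounded L m -> searching m w bw ->
  runs L (evaluate k) m (fun m' => [/\ searching m' w bw, 0 < m' (Negz vQ) &
    (m' (Negz vP))%:~R / (m' (Negz vQ))%:~R = word_value w]).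
Proof.
move=> wn mL sm.
apply: runs_seq; apply: runs_store => // [|m1L]; first exact: (fits_small L_gt1).
apply: runs_seq; apply: runs_store => // [|m2L]; first exact: (fits_small L_gt1).
set m2 := upd _ _ _ in m2L *.
have sm2 : searching m2 w bw by do 2![apply: searching_upd => //].
have Q2 : 0 < m2 (Negz vQ) by [].
have : all (fun ab => (ab.1 < k)%N && (ab.2 < k)%N) (index_pairs k).
  by apply/allP=> ab /allpairsP[[i j] /= []]; rewrite !mem_iota /= => ik jk ->; apply/andP.
have bP : below (0 * trace_bits) (m2 (Negz vP)) by [].
have bQ : below (0 * trace_bits) (m2 (Negz vQ)) by [].
rewrite /word_value.
suff H s i m' : (i + size s = size (index_pairs k))%N -> bounded L m' ->
    searching m' w bw -> 0 < m' (Negz vQ) ->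
    below (i * trace_bits) (m' (Negz vP)) ->
    below (i * trace_bits) (m' (Negz vQ)) ->
    all (fun ab => (ab.1 < k)%N && (ab.2 < k)%N) s ->
    runs L (sequence multiply_trace s) m' (fun m'' => [/\ searching m'' w bw,
      0 < m'' (Negz vQ) & (m'' (Negz vP))%:~R / (m'' (Negz vQ))%:~R =
      (m' (Negz vP))%:~R / (m' (Negz vQ))%:~R *
        \prod_(ab <- s) correlation (w ab.1) (w ab.2)]).
  move=> allk; apply: runs_weaken (H _ 0%N m2 _ m2L sm2 Q2 bP bQ allk) _ => // m3 _.
  by rewrite -[m2 _]/1 -[m2 _]/1 divr1 mul1r.
elim: s i m' => [|[a b] s IHs] i m' isk m'L sm' Q' bP' bQ' allk.
  by apply: runs_skip => //; split=> //; rewrite big_nil mulr1.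
move: allk => /= /andP[/andP[ak bk] sk].
have iL : (i * trace_bits + trace_bits < L)%N.
  apply: leq_ltn_trans ltvalueL; rewrite addnC -mulSn leq_mul2r.
  by rewrite -isk /= addnS ltnS leq_addr orbT.
apply: runs_seq.
apply: runs_weaken (runs_multiply_trace ak bk (wn _ ak) (wn _ bk) iL m'L sm' bP' bQ') _.
move=> m1 m1L' [sm1 [x [y [y0 xy [bx bY] mP mQ]]]].
have siS : (i.+1 * trace_bits = i * trace_bits + trace_bits)%N by rewrite mulSn addnC.
have Q1 : 0 < m1 (Negz vQ) by rewrite mQ mulr_gt0.
apply: runs_weaken (IHs i.+1 m1 _ m1L' sm1 Q1 _ _ sk) _.
- by rewrite -isk addSnnS.
- by rewrite siS mP belowM.
- by rewrite siS mQ belowM.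
move=> m3 _ [sm3 Q3 ->]; split=> //.
rewrite big_cons mulrA; congr (_ * _); rewrite /= -xy mP mQ !rmorphM /=.
by rewrite invfM mulrACA.
Qed.

Lemma runs_save_word m : bounded L m ->
  runs L (save_word k) m (fun m' =>
    (forall j, (j < k)%N -> m' (Negz (vBW j)) = m (Negz (vW j))) /\
    (forall a, (forall j, a <> Negz (vBW j)) -> m' a = m a)).
Proof.
move=> mL; rewrite /save_word.
suff H s m' : bounded L m' ->
    runs L (sequence (fun j => assign (vBW j) (read (vW j))) s) m' (fun m'' =>
    (forall j, m'' (Negz (vBW j)) =
       if j \in s then m' (Negz (vW j)) else m' (Negz (vBW j))) /\
    (forall a, (forall j, a <> Negz (vBW j)) -> m'' a = m' a)).
  apply: runs_weaken (H _ _ mL) _ => m' _ [saved kept]; split=> // j jk.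
  by rewrite saved mem_iota jk.
elim: s m' => [|i s IHs] m' m'L; first by apply: runs_skip.
apply: runs_seq; apply: runs_store => // [|m1L]; first exact: (m'L (Negz (vW i))).
set m1 := upd _ _ _ in m1L *.
apply: runs_weaken (IHs m1 m1L) _ => m2 _ [saved kept]; split=> [j|a aBW].
  have -> : m2 (Negz (vBW j)) = _ := saved j.
  have -> : m1 (Negz (vW j)) = m' (Negz (vW j)).
    by rewrite /m1 updE; case: eqP => // -[]; rewrite /vW /vBW; lia.
  rewrite inE; case: (j \in s); first by rewrite orbT.
  rewrite orbF /m1 updE /=; case: (eqVneq j i) => [->|ji]; first by rewrite eqxx.
  by case: eqP => // -[]; rewrite /vBW; move/eqP: ji; lia.
rewrite kept // /m1 updE; case: eqP => // a_i.
by have := aBW i.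
Qed.

Lemma runs_challenge m w bw : valid_word w -> bounded L m -> searching m w bw ->
  runs L (challenge k) m (fun m' => exists bw', [/\ searching m' w bw',
    word_value bw' <= word_value bw & word_value bw' <= word_value w]).
Proof.
move=> wn mL sm; apply: runs_seq.
apply: runs_weaken (runs_evaluate wn mL sm) _ => m1 m1L [sm1 Q1 val1].
have BQ1 := best_den_gt0 sm1; have BP1 := best_value sm1.
have guardE : (eval m1 (Sub (Mul (read vBP) (read vQ)) (Mul (read vP) (read vBQ))) <= 0)
    = (word_value bw <= word_value w).
  rewrite -val1 -BP1 ler_pdivrMr ?ltr0z // mulrAC ler_pdivlMr ?ltr0z //.
  by rewrite -!intrM ler_int subr_le0.
apply: runs_if => //; last first.
  by rewrite guardE => bww; apply: runs_skip => //; exists bw.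
rewrite ltNge guardE -ltNge => /ltW bww.
apply: runs_seq; apply: runs_store => // [|m2L]; first exact: (m1L (Negz vP)).
apply: runs_seq; apply: runs_store => // [|m3L]; first exact: (m2L (Negz vQ)).
apply: runs_weaken (runs_save_word m3L) _ => m4 m4L [saved kept].
exists w; split=> //.
have kept_pos (c : nat) : m4 c%:Z = m1 c%:Z by rewrite kept.
have kept_neg u : (u < 7)%N -> m4 (Negz u) = m1 (Negz u).
  move=> u7; rewrite kept => [|j []]; last by rewrite /vBW; lia.
  by rewrite !updE; do 2?[case: eqP => [[] ?|_]; first by exfalso; lia].
have kept_w j : m4 (Negz (vW j)) = m1 (Negz (vW j)).
  rewrite kept => [|i []]; last by rewrite /vW /vBW; lia.
  by rewrite !updE; do 2?[case: eqP => [[]|_]; first by rewrite /vW; lia].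
have mBP : m4 (Negz vBP) = m1 (Negz vP) by rewrite kept // => j []; rewrite /vBW; lia.
have mBQ : m4 (Negz vBQ) = m1 (Negz vQ) by rewrite kept // => j []; rewrite /vBW; lia.
case: sm1 => mn md mN mD mw mbw q0 val vbw.
have mBW j : (j < k)%N -> m4 (Negz (vBW j)) = w j.
  move=> jk; rewrite saved // -(mw j jk).
  by rewrite !updE; do 2?[case: eqP => [[]|_]; first by rewrite /vW; lia].
split=> [t|t|||j|j jk|||]; rewrite ?kept_pos ?kept_w ?mBP ?mBQ ?mBW //; auto.
- by rewrite kept_neg.
- by rewrite kept_neg.
Qed.

Lemma searching_updW m w bw r (x : nat) : searching m w bw ->
  searching (upd m (Negz (vW r)) x) (fun j => if j == r then x else w j) bw.
Proof.
move=> [mn md mN mD mw mbw q0 val vbw].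
split=> [t tnD|t tnD|||j jk|j jk|||//]; rewrite updE /=; auto.
- have -> : (Negz (vW j) == Negz (vW r)) = (j == r).
    by apply/eqP/eqP => [[]|->//]; rewrite /vW; lia.
  by case: eqP => // _; apply: mw.
- by case: eqP => [[]|_]; [rewrite /vW /vBW; lia|apply: mbw].
Qed.

(** Induction over the nesting depth: letters of index at least [r] keep their
    values, so the words enumerated are those that extend them, whatever the
    cells of the other letters contain at the start. *)
Lemma runs_search r m w bw : (r <= k)%N ->
  (forall j, (r <= j < k)%N -> (w j < n)%N) -> bounded L m -> searching m w bw ->
  runs L (search k r) m (fun m' => exists w' bw', [/\ searching m' w' bw',
    (forall j, (r <= j < k)%N -> w' j = w j),
    word_value bw' <= word_value bw &
    forall v, valid_word v -> (forall j, (r <= j < k)%N -> v j = w j) ->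
      word_value bw' <= word_value v]).
Proof.
elim: r m w bw => [|r IHr] m w bw rk wn mL sm.
  have w_valid : valid_word w by move=> j jk; apply: wn.
  apply: runs_weaken (runs_challenge w_valid mL sm) _ => m' _ [bw' [sm' le_bw le_w]].
  exists w, bw'; split=> // v v_valid vw.
  suff -> : word_value v = word_value w by [].
  rewrite /word_value !big_seq; apply: eq_bigr => -[a b].
  case/allpairsP=> [[i j] /= []]; rewrite !mem_iota /= => ik jk [-> ->].
  by rewrite !vw.
apply: runs_seq; apply: runs_store => // [|m1L]; first exact: (fits_small L_gt0).
have := searching_updW r 0%N sm; set m1 := upd _ _ _ => sm1.
pose Inv (i : nat) m' := exists w' bw', [/\ searching m' w' bw', w' r = i,
  (forall j, (r < j < k)%N -> w' j = w j), word_value bw' <= word_value bw &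
  forall v, valid_word v -> (forall j, (r < j < k)%N -> v j = w j) ->
    (v r < i)%N -> word_value bw' <= word_value v].
apply: (runs_while (J := n) L_gt0 (Inv := Inv)) => //.
- by apply: leq_trans lenB (ltnW ltBL).
- eexists; exists bw; split; [exact: sm1|by rewrite /= eqxx| | by [] | by []].
  by move=> j /andP[rj _]; rewrite /= gtn_eqF.
- move=> i m2 i_n m2L [w2 [bw2 [sm2 w2r w2j le2 min2]]].
  split; first by rewrite /= (stored_n sm2) (current_word sm2 rk) w2r subr_gt0 ltz_nat.
  have w2n j : (r <= j < k)%N -> (w2 j < n)%N.
    move=> /andP[]; rewrite leq_eqVlt => /orP[/eqP <-|rj] jk; first by rewrite w2r.
    by rewrite w2j ?rj // wn ?rj.
  apply: runs_seq.
  apply: runs_weaken (IHr m2 w2 bw2 (ltnW rk) w2n m2L sm2) _.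
  move=> m3 m3L [w3 [bw3 [sm3 w3j le3 min3]]].
  have incE : eval m3 (Add (read (vW r)) (Const 1)) = i.+1.
    by rewrite /= (current_word sm3 rk) w3j ?leqnn // w2r -addn1.
  apply: runs_store => //; rewrite incE.
    by apply: fits_small; apply: leq_ltn_trans ltBL; apply: leq_trans i_n lenB.
  move=> m4L; eexists; exists bw3; split; first exact: searching_updW sm3.
  + by rewrite /= eqxx.
  + move=> j /andP[rj jk]; rewrite /= gtn_eqF // w3j ?(ltnW rj) //.
    by rewrite w2j ?rj.
  + exact: le_trans le3 le2.
  + move=> v v_valid vw; rewrite ltnS leq_eqVlt => /orP[/eqP vri|vri].
      apply: min3 => // j /andP[]; rewrite leq_eqVlt => /orP[/eqP <- _|rj jk].
        by rewrite w2r.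
      by rewrite vw ?rj // w2j ?rj.
    by apply: le_trans le3 (min2 v v_valid vw vri).
move=> m2 m2L [w2 [bw2 [sm2 w2r w2j le2 min2]]].
split; first by rewrite /= (stored_n sm2) (current_word sm2 rk) w2r subrr.
exists w2, bw2; split=> // v v_valid vw; apply: min2 => //.
exact: v_valid.
Qed.

Definition occurrences (w : nat -> nat) (i : nat) : nat :=
  count_mem i (map w (iota 0 k)).

Lemma runs_write_frequencies m w : valid_word w -> bounded L m ->
  m (Negz vN) = n -> (forall j, (j < k)%N -> m (Negz (vBW j)) = w j) ->
  runs L (write_frequencies k) m (fun m' => forall i, (i < n)%N ->
    m' (2 * i)%N%:Z = occurrences w i /\ m' (2 * i + 1)%N%:Z = k).
Proof.
move=> wn mL mN mw.
apply: runs_seq; apply: runs_store => // [|m1L]; first exact: (fits_small L_gt0).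
set m1 := upd _ _ _ in m1L *.
have vBW_neq j : (Negz (vBW j) == Negz vT) = false by [].
apply: runs_seq.
pose Inv (t : nat) (m' : memory) := [/\ m' (Negz vN) = n, m' (Negz vT) = t,
  (forall j, (j < k)%N -> m' (Negz (vBW j)) = w j) &
  forall i, (i < t)%N -> m' (2 * i)%N%:Z = 0 /\ m' (2 * i + 1)%N%:Z = k].
apply: (runs_while (J := n) L_gt0 (Inv := Inv)) => //.
- by apply: leq_trans lenB (ltnW ltBL).
- move=> t m2 t_n m2L [m2N m2T m2w m2o].
  split; first by rewrite /= m2N m2T subr_gt0 ltz_nat.
  apply: runs_seq; apply: runs_store => // [|m3L]; first exact: (fits_small L_gt0).
  have -> : eval m2 (num_out (read vT)) = (2 * t)%N%:Z by rewrite /= m2T PoszM.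
  set m3 := upd _ _ _.
  have m3L' : bounded L m3.
    by move=> a; rewrite /m3 updE; case: ifP => // _; exact: (fits_small L_gt0).
  have denE : eval m3 (den_out (read vT)) = (2 * t + 1)%N%:Z.
    by rewrite -[LHS]/(2 * m2 (Negz vT) + 1) m2T; lia.
  apply: runs_seq; apply: runs_store => // [|m4L]; first exact: (fits_small ltkL).
  rewrite denE in m4L *; set m4 := upd _ _ _ in m4L *.
  have incE : eval m4 (Add (read vT) (Const 1)) = t.+1.
    by rewrite -[LHS]/(m2 (Negz vT) + 1) m2T -addn1.
  apply: runs_store => //; rewrite incE.
    by apply: fits_small; apply: leq_ltn_trans ltBL; apply: leq_trans t_n lenB.
  have num4 i : m4 (2 * i)%N%:Z = if i == t then 0 else m2 (2 * i)%N%:Z.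
    rewrite /m4 updE; case: eqP => [[]|_]; first lia.
    rewrite /m3 updE; case: (eqVneq i t) => [->|it]; first by rewrite eqxx.
    by case: eqP => // -[]; move/eqP: it; lia.
  have den4 i : m4 (2 * i + 1)%N%:Z = if i == t then k%:Z else m2 (2 * i + 1)%N%:Z.
    rewrite /m4 updE; case: (eqVneq i t) => [->|it]; first by rewrite eqxx.
    case: eqP => [[]|_]; first by move/eqP: it; lia.
    by rewrite /m3 updE; case: eqP => // -[]; lia.
  move=> m5L; split=> // i; rewrite -[upd _ _ _ (2 * i)%N%:Z]/(m4 (2 * i)%N%:Z).
  rewrite -[upd _ _ _ (2 * i + 1)%N%:Z]/(m4 (2 * i + 1)%N%:Z) num4 den4.
  by rewrite ltnS leq_eqVlt; case: eqP => [//|_ /=]; apply: m2o.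
move=> m2 m2L [m2N m2T m2w m2o]; split; first by rewrite /= m2N m2T subrr.
rewrite /occurrences.
have : all (fun j => (j < k)%N) (iota 0 k).
  by apply/allP=> j; rewrite mem_iota.
(* The counter [c] of increments bounds every count, which therefore fits. *)
suff H s c m' : (c + size s = k)%N -> bounded L m' ->
    (forall j, (j < k)%N -> m' (Negz (vBW j)) = w j) ->
    (forall i, (i < n)%N -> (`|m' (2 * i)%N%:Z| <= c)%N) ->
    all (fun j => (j < k)%N) s ->
    runs L (sequence count_letter s) m' (fun m'' => forall i, (i < n)%N ->
      m'' (2 * i)%N%:Z = m' (2 * i)%N%:Z + (count_mem i (map w s))%:Z /\
      m'' (2 * i + 1)%N%:Z = m' (2 * i + 1)%N%:Z).
  move=> allk; have m20 i : (i < n)%N -> (`|m2 (2 * i)%N%:Z| <= 0)%N.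
    by move=> /m2o[->].
  have ck : (0 + size (iota 0 k) = k)%N by rewrite size_iota.
  apply: runs_weaken (H _ _ m2 ck m2L m2w m20 allk) _ => m3 _ m3o i i_n.
  by have [-> ->] := m3o i i_n; have [-> ->] := m2o i i_n; rewrite add0r.
elim: s c m' => [|j s IHs] c m' csk m'L m'w m'c.
  by move=> _; apply: runs_skip => // i _; rewrite addr0.
move=> /= /andP[jk sk].
have cellE : eval m' (num_out (read (vBW j))) = (2 * w j)%N%:Z.
  by rewrite /= m'w // PoszM.
have cL : (c.+1 < L)%N by apply: leq_ltn_trans ltkL; rewrite -csk /= addnS ltnS leq_addr.
have valE : eval m' (Add (Fetch (num_out (read (vBW j)))) (Const 1)) =
    m' (2 * w j)%N%:Z + 1 by rewrite -cellE.
apply: runs_seq; apply: runs_store => //; rewrite ?cellE valE.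
  apply: (@below_fits c.+1) => //; rewrite /below.
  have := m'c _ (wn j jk); have := ltn_expl c.+1 (isT : (1 < 2)%N); lia.
move=> m3L; set m3 := upd _ _ _ in m3L *.
have m3E i : m3 (2 * i)%N%:Z = m' (2 * i)%N%:Z + (w j == i).
  rewrite /m3 updE; case: (eqVneq (w j) i) => [->|wji]; first by rewrite eqxx.
  by rewrite addr0; case: eqP => // -[]; move/eqP: wji; lia.
have c_next : (c.+1 + size s = k)%N by rewrite -csk addSnnS.
apply: runs_weaken (IHs c.+1 m3 c_next m3L m'w _ sk) _.
  by move=> i i_n; rewrite m3E; have := m'c i i_n; case: (w j == i); lia.
move=> m4 _ m4o i i_n; have [-> ->] := m4o i i_n.
rewrite m3E -addrA; split=> //.
by rewrite /m3 updE; case: eqP => // -[]; lia.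
Qed.

Lemma runs_best_word_program m (d : nat) : D = (d * d)%N -> correlation 0 0 = 1 ->
  bounded L m -> m 0 = n -> m 1 = d -> (forall v, m (Negz v) = 0) ->
  (forall t, (t < n * D)%N -> m (2 + 2 * t)%N%:Z = numq (E t)) ->
  (forall t, (t < n * D)%N -> m (3 + 2 * t)%N%:Z = denq (E t)) ->
  runs L (best_word_program k) m (fun m' => exists w, [/\ valid_word w,
    forall v, valid_word v -> word_value w <= word_value v &
    forall i, (i < n)%N ->
      m' (2 * i)%N%:Z = occurrences w i /\ m' (2 * i + 1)%N%:Z = k]).
Proof.
move=> Dd cor00 mL m0 m1 mneg mnum mden.
apply: runs_seq; apply: runs_store => // [|m1L]; first exact: (mL 0).
apply: runs_seq; apply: runs_store => //.
  rewrite -[eval _ _]/(m 1 * m 1) m1 -PoszM -Dd.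
  exact: fits_small (leq_ltn_trans leDB ltBL).
move=> m2L.
apply: runs_seq; apply: runs_store => // [|m3L]; first exact: (fits_small L_gt1).
apply: runs_seq; apply: runs_store => // [|m4L]; first exact: (fits_small L_gt1).
set m4 := upd _ _ _ in m4L *.
have m4W j : m4 (Negz (vW j)) = 0 by rewrite -(mneg (vW j)).
have m4BW j : m4 (Negz (vBW j)) = 0 by rewrite -(mneg (vBW j)).
have val0 : word_value (fun=> 0%N) = 1 by rewrite /word_value big1.
have sm4 : searching m4 (fun=> 0%N) (fun=> 0%N).
  split=> //.
  by rewrite -[LHS]/(m 1 * m 1) m1 Dd PoszM.
apply: runs_seq.
have vac j : (k <= j < k)%N -> ((fun=> 0%N) j < n)%N by [].
apply: runs_weaken (runs_search (leqnn k) vac m4L sm4) _.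
move=> m5 m5L [w' [w [sm5 _ _ w_min]]].
have w_valid := best_valid sm5.
apply: runs_weaken (runs_write_frequencies w_valid m5L (stored_n sm5) (best_word sm5)) _.
move=> m6 _ freq; exists w; split=> // v v_valid.
by apply: w_min => // j /andP[kj /(leq_ltn_trans kj)]; rewrite ltnn.
Qed.

End Correctness.
(** * Reading the input *)

Section Input.
Variables (n d : nat) (A : 'I_n -> 'M[rat]_d).

Definition positions : seq ('I_d * 'I_d) :=
  [seq (r, s) | r <- enum 'I_d, s <- enum 'I_d].

Definition block (i : 'I_n) : seq rat := [seq A i rs.1 rs.2 | rs <- positions].

Definition entries : seq rat := flatten [seq block i | i <- enum 'I_n].

Definition trace_mul (i j : 'I_n) : rat := \sum_(r < d) \sum_(s < d) A i r s * A j r s.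

Lemma flatten_map_flatten (T U V : Type) (f : U -> seq V) (g : T -> seq U) (s : seq T) :
  flatten [seq flatten [seq f y | y <- g x] | x <- s] =
  flatten [seq f y | y <- flatten [seq g x | x <- s]].
Proof. by elim: s => //= x s ->; rewrite map_cat flatten_cat. Qed.

Lemma encode_inputE :
  encode_input A = n%:Z :: d%:Z :: flatten [seq encode_rat q | q <- entries].
Proof.
rewrite /encode_input /entries -flatten_map_flatten.
congr [:: _, _ & flatten _]; apply: eq_map => i; congr flatten.
by rewrite /block /positions !map_allpairs.
Qed.

Lemma size_positions : size positions = (d * d)%N.
Proof. by rewrite size_allpairs -cardE card_ord. Qed.

Lemma size_block i : size (block i) = (d * d)%N.
Proof. by rewrite size_map size_positions. Qed.

Lemma nth_flatten_pairs (T : Type) (f g : T -> int) x0 (s : seq T) t :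
  (t < size s)%N ->
  nth 0 (flatten [seq [:: f x; g x] | x <- s]) (2 * t) = f (nth x0 s t) /\
  nth 0 (flatten [seq [:: f x; g x] | x <- s]) (2 * t).+1 = g (nth x0 s t).
Proof.
elim: s t => [//|x s IHs] [//|t] ts.
by rewrite mulnS /=; apply: IHs.
Qed.

Lemma nth_flatten_uniform (T U : Type) (g : T -> seq U) m x0 y0 (s : seq T) j t :
  (forall x, size (g x) = m) -> (j < size s)%N -> (t < m)%N ->
  nth y0 (flatten (map g s)) (j * m + t) = nth y0 (g (nth x0 s j)) t.
Proof.
move=> gm; elim: s j => [//|x s IHs] [|j] js tm /=; rewrite nth_cat gm.
  by rewrite mul0n tm.
by rewrite mulSn -addnA ltnNge leq_addr /= addKn IHs.
Qed.

Lemma size_entries : size entries = (n * (d * d))%N.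
Proof.
rewrite size_flatten /shape -map_comp (eq_map (g := fun=> (d * d)%N)); last first.
  by move=> i /=; rewrite size_block.
by rewrite sumnE big_map big_const_seq count_predT iter_addn_0 size_enum_ord mulnC.
Qed.

Lemma entries_block (i : 'I_n) t : (t < d * d)%N ->
  nth 0 entries (i * (d * d) + t) = nth 0 (block i) t.
Proof.
move=> td; rewrite (nth_flatten_uniform i _ size_block) ?size_enum_ord //.
by rewrite nth_ord_enum.
Qed.

Lemma sum_nth_map (T : Type) (f g : T -> rat) (s : seq T) :
  \sum_(t < size s) nth 0 (map f s) t * nth 0 (map g s) t = \sum_(x <- s) f x * g x.
Proof.
elim: s => [|x s IHs]; first by rewrite big_ord0 big_nil.
by rewrite big_ord_recl big_cons -IHs.
Qed.

Lemma correlation_entries (i j : 'I_n) :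
  correlation (d * d) (nth 0 entries) i j = trace_mul i j.
Proof.
rewrite /correlation (eq_bigr (fun t : 'I_(d * d) =>
  nth 0 (block i) t * nth 0 (block j) t)); last by move=> t _; rewrite !entries_block.
rewrite -size_positions sum_nth_map big_allpairs big_enum; apply: eq_bigr => r _.
by rewrite big_enum.
Qed.

Lemma entry_bitsize (i : 'I_n) r s :
  (bitsize (numq (A i r s)) + bitsize (denq (A i r s)) <= bit_complexity A)%N.
Proof.
have term m (F : 'I_m -> nat) j : (F j <= \sum_(x < m) F x)%N.
  by rewrite (bigD1 j) //= leq_addr.
apply: leq_trans (term n _ i); apply: leq_trans (term d _ r).
exact: (term d (fun x => bitsize (numq (A i r x)) + bitsize (denq (A i r x)))%N).
Qed.

Lemma leq_dd_bit_complexity : (0 < n)%N -> (d * d <= bit_complexity A)%N.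
Proof.
move=> n_gt0; pose i := Ordinal n_gt0.
rewrite /bit_complexity (bigD1 i) //=; apply: leq_trans _ (leq_addr _ _).
have -> : (d * d = \sum_(r < d) \sum_(s < d) 1)%N.
  by rewrite !sum_nat_const !card_ord muln1.
by apply: leq_sum => r _; apply: leq_sum => s _.
Qed.

Hypothesis n_gt0 : (0 < n)%N.
Let B := (n + bit_complexity A)%N.

Lemma fits_entry t :
  fits B (numq (nth 0 entries t)) /\ fits B (denq (nth 0 entries t)).
Proof.
have [ts|ts] := ltnP t (size entries); last first.
  rewrite nth_default //; split; first by rewrite /fits expn_gt0.
  by rewrite /fits -[denq 0]/(1%:Z) /= -[X in (X < _)%N](expn0 2) ltn_exp2l // /B addn_gt0 n_gt0.
have /flattenP[_ /mapP[i _ ->] /mapP[rs _ ->]] := mem_nth 0 ts.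
have le_bits := entry_bitsize i rs.1 rs.2.
split; apply: fits_leq (fits_bitsize _); rewrite /B.
  exact: leq_trans (leq_trans (leq_addr _ _) le_bits) (leq_addl _ _).
exact: leq_trans (leq_trans (leq_addl _ _) le_bits) (leq_addl _ _).
Qed.

Lemma bounded_input L : (B < L)%N -> bounded L (init_mem (encode_input A)).
Proof.
move=> BL [t|t]; last by rewrite /fits expn_gt0.
have small (x : nat) : (x <= B)%N -> fits L x%:Z.
  move=> xB; apply: leq_trans (ltn_expl x (isT : (1 < 2)%N)) _.
  by rewrite leq_exp2l // (leq_trans xB (ltnW BL)).
rewrite /init_mem encode_inputE.
have fit z : z \in n%:Z :: d%:Z :: flatten [seq encode_rat q | q <- entries] -> fits L z.
  rewrite !inE => /or3P[/eqP ->|/eqP ->|/flattenP[_ /mapP[q q_in ->]]].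
  - by apply: small; rewrite leq_addr.
  - apply: small; apply: leq_trans _ (leq_addl _ _).
    apply: leq_trans _ (leq_dd_bit_complexity n_gt0).
    by case: (d) => // d'; rewrite leq_pmulr.
  - have [fn fd] := fits_entry (index q entries).
    rewrite nth_index // in fn fd.
    by rewrite !inE => /orP[] /eqP ->; apply: fits_leq (ltnW BL) _.
have [ts|ts] := ltnP t (size (n%:Z :: d%:Z :: flatten [seq encode_rat q | q <- entries])).
  by apply: fit; apply: mem_nth.
by rewrite nth_default // /fits expn_gt0.
Qed.

Lemma input_entry t : (t < n * (d * d))%N ->
  init_mem (encode_input A) (2 + 2 * t)%N%:Z = numq (nth 0 entries t) /\
  init_mem (encode_input A) (3 + 2 * t)%N%:Z = denq (nth 0 entries t).
Proof.
rewrite -size_entries => ts; rewrite /init_mem encode_inputE.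
exact: (nth_flatten_pairs _ _ _ ts).
Qed.

End Input.

(** With [x] the size of the input, the search multiplies [k * k] traces, each of
    which is a sum of at most [x] fractions whose numerators and denominators
    have [2 * x] bits; the remaining terms cover counters and input cells. *)
Definition length_bound (k : nat) : {poly nat} :=
  (k * k)%N%:P * ((2%N%:P * 'X + 1) * 'X) + 'X + (k.+1)%:P.

Lemma length_boundE k x :
  (length_bound k).[x] = (k * k * trace_bits x + x + k.+1)%N.
Proof.
rewrite /length_bound !hornerD hornerX hornerC.
rewrite [((_)%:P * _).[_]]hornerM [((_ + _) * _).[_]]hornerM hornerD hornerM !hornerC hornerX.
by [].
Qed.

(** This is all that the analysis has to know about the program. *)
Lemma best_word_algorithm (k n d : nat) (A : 'I_n -> 'M[rat]_d) :
  (0 < n)%N -> (forall i, trace_mul A i i = 1) ->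
  exists (t : nat) (m : memory) (w : {ffun 'I_k -> 'I_n}), [/\
    exec (best_word_program k) (init_mem (encode_input A)) t m,
    (t <= (time_bound (best_word_program k) \Po length_bound k).[n + bit_complexity A])%N,
    forall v : {ffun 'I_k -> 'I_n},
      \prod_(a < k) \prod_(b < k) trace_mul A (w a) (w b) <=
      \prod_(a < k) \prod_(b < k) trace_mul A (v a) (v b) &
    forall i : 'I_n, m (2 * i)%N%:Z = (\sum_(a < k) (w a == i))%N /\
                     m (2 * i + 1)%N%:Z = k].
Proof.
move=> n_gt0 tr1; set B := (n + bit_complexity A)%N.
set L := (length_bound k).[B]; have LE : L = _ := length_boundE k B.
pose E := nth 0 (entries A).
have valueE (w : nat -> nat) (v : 'I_k -> 'I_n) : (forall a : 'I_k, w a = v a) ->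
    word_value k (d * d) E w = \prod_(a < k) \prod_(b < k) trace_mul A (v a) (v b).
  move=> wv; rewrite /word_value big_allpairs -{1}[k]subn0 big_mkord.
  apply: eq_bigr => a _; rewrite -{1}[k]subn0 big_mkord; apply: eq_bigr => b _.
  by rewrite !wv correlation_entries.
have ddB : (d * d <= B)%N.
  by apply: leq_trans (leq_dd_bit_complexity A n_gt0) (leq_addl _ _).
have sz : size (index_pairs k) = (k * k)%N by rewrite size_allpairs size_iota.
have nB : (n <= B)%N by apply: leq_addr.
have BL : (B < L)%N by rewrite LE; lia.
have kL : (k < L)%N by rewrite LE; lia.
have vL : (size (index_pairs k) * trace_bits B < L)%N by rewrite LE sz; lia.
have fits_num t := (fits_entry A n_gt0 t).1.
have fits_den t := (fits_entry A n_gt0 t).2.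
have cor00 : correlation (d * d) E 0 0 = 1.
  by rewrite -(tr1 (Ordinal n_gt0)) -correlation_entries.
have mL := bounded_input n_gt0 BL.
have inE t tn := (@input_entry _ _ A t tn).1.
have idE t tn := (@input_entry _ _ A t tn).2.
have [t [m [ex tL _ [w [wn w_min freq]]]]] := runs_best_word_program
  n_gt0 ddB nB BL kL fits_num fits_den vL (erefl (d * d)%N) cor00 mL
  (erefl n%:Z) (erefl d%:Z) (fun=> erefl 0) inE idE.
pose wf : {ffun 'I_k -> 'I_n} := [ffun a : 'I_k => Ordinal (wn a (ltn_ord a))].
exists t, m, wf; split=> //.
- by rewrite horner_comp.
- move=> v; pose v' j := oapp (fun a : 'I_k => v a : nat) 0%N (insub j).
  have v'E (a : 'I_k) : v' a = v a by rewrite /v' valK.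
  have v'n : valid_word k n v' by move=> j jk; rewrite -[j]/(val (Ordinal jk)) v'E.
  rewrite -(valueE _ _ v'E) -(valueE w); first exact: w_min.
  by move=> a; rewrite ffunE.
- move=> i; have [-> ->] := freq i (ltn_ord i); split=> //; congr Posz.
  rewrite /occurrences count_map -sum1_count -{1}[k]subn0 big_mkord big_mkcond /=.
  by apply: eq_bigr => a _; rewrite ffunE -val_eqE /=; case: eqP.
Qed.

(** * Words of independent letters *)

Section IndependentLetters.
Variables (R : realType) (k n : nat) (p : 'I_n -> R).
Hypothesis p_sum : \sum_i p i = 1.

Lemma word_weight_sum : \sum_(w : {ffun 'I_k -> 'I_n}) \prod_c p (w c) = 1.
Proof.
by rewrite -(bigA_distr_bigA (fun _ i => p i)) big1.
Qed.

(** Indicators of the values at [a] and [b] turn the expectation into a product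
    over all positions, where every other position contributes the factor [1]. *)
Lemma word_expectation_pair (f : 'I_n -> 'I_n -> R) (a b : 'I_k) : a != b ->
  \sum_(w : {ffun 'I_k -> 'I_n}) (\prod_c p (w c)) * f (w a) (w b) =
  \sum_i \sum_j p i * p j * f i j.
Proof.
move=> ab; pose g (i j : 'I_n) (c : 'I_k) (x : 'I_n) : R :=
  (if c == a then (x == i)%:R else 1) * (if c == b then (x == j)%:R else 1).
have prod_g i j (w : {ffun 'I_k -> 'I_n}) :
    \prod_c g i j c (w c) = (w a == i)%:R * (w b == j)%:R.
  rewrite big_split /= -big_mkcond big_pred1_eq; congr (_ * _).
  by rewrite -big_mkcond big_pred1_eq.
have expand (w : {ffun 'I_k -> 'I_n}) : (\prod_c p (w c)) * f (w a) (w b) =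
    \sum_i \sum_j f i j * \prod_c (p (w c) * g i j c (w c)).
  have term i j : f i j * \prod_c (p (w c) * g i j c (w c)) =
      (\prod_c p (w c)) * f i j * ((w a == i)%:R * (w b == j)%:R).
    by rewrite big_split /= prod_g mulrCA mulrA.
  rewrite (bigD1 (w a)) //= [X in _ = _ + X]big1 => [|i ia].
    rewrite addr0 (bigD1 (w b)) //= [X in _ = _ + X]big1 => [|j jb].
      by rewrite term !eqxx !mulr1 addr0.
    by rewrite term [w b == j]eq_sym (negbTE jb) !mulr0.
  by apply: big1 => j _; rewrite term [w a == i]eq_sym (negbTE ia) mul0r mulr0.
under eq_bigr => w _ do rewrite expand.
rewrite exchange_big /=; apply: eq_bigr => i _.
rewrite exchange_big /=; apply: eq_bigr => j _.
rewrite -mulr_sumr -(bigA_distr_bigA (fun c x => p x * g i j c x)) mulrC; congr (_ * _).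
rewrite (bigD1 a) //= (bigD1 b) 1?eq_sym //= [X in _ * (_ * X)]big1 => [|c /andP[ca cb]].
  rewrite mulr1.
  congr (_ * _); rewrite /g eqxx.
    rewrite (negbTE ab) (bigD1 i) //= eqxx !mulr1 big1 ?addr0 // => x xi.
    by rewrite (negbTE xi) mul0r mulr0.
  rewrite eq_sym (negbTE ab) (bigD1 j) //= !eqxx !mulr1 big1 ?addr0 // => x xj.
  by rewrite (negbTE xj) mulr0 mulr0.
by rewrite -[RHS]p_sum; apply: eq_bigr => x _; rewrite /g (negbTE ca) (negbTE cb) !mulr1.
Qed.

End IndependentLetters.

(** * The Lyapunov exponent of rank one projections *)

Section UnitVectors.
Variables (R : realType) (d : nat).
Implicit Types u v : 'cV[R]_d.

Lemma norm2_1 u : norm2 u = 1 -> dot u u = 1.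
Proof.
rewrite /norm2 /dot => u1; under eq_bigr => k _ do rewrite -expr2.
by rewrite -[LHS]sqr_sqrtr ?u1 ?expr1n // sumr_ge0 // => k _; rewrite sqr_ge0.
Qed.

Lemma dot_norm_le1 u v : norm2 u = 1 -> norm2 v = 1 -> `|dot u v| <= 1.
Proof.
move=> /norm2_1 uu /norm2_1 vv.
have expand (s : R) : 0 <= dot u u + 2 * s * dot u v + s ^+ 2 * dot v v.
  rewrite /dot !mulr_sumr -!big_split /=; apply: sumr_ge0 => k _.
  by have := sqr_ge0 (u k 0 + s * v k 0); congr (_ <= _); ring.
have := expand 1; have := expand (-1); rewrite uu vv ler_norml => h1 h2.
by apply/andP; split; lra.
Qed.

Lemma cos_angle u v : norm2 u = 1 -> norm2 v = 1 -> cos (angle u v) = dot u v.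
Proof.
move=> u1 v1; rewrite /angle u1 v1 mulr1 divr1 acosK // in_itv /=.
by rewrite -ler_norml dot_norm_le1.
Qed.

Lemma mul_rank1 (a b c : 'cV[R]_d) :
  (a *m a^T) *m (b *m c^T) = dot a b *: (a *m c^T).
Proof.
rewrite mulmxA -[a *m a^T *m b]mulmxA.
have -> : a^T *m b = (dot a b)%:M.
  apply/matrixP=> i j; rewrite !ord1 !mxE eqxx mulr1n.
  by apply: eq_bigr => k _; rewrite mxE.
by rewrite mul_mx_scalar -scalemxAl.
Qed.

End UnitVectors.

Section RankOne.
Variables (R : realType) (n d : nat) (u : 'I_n -> 'cV[R]_d).
Hypothesis unit_u : forall i, norm2 (u i) = 1.
Hypothesis dot_neq0 : forall i j, dot (u i) (u j) != 0.

Definition log_dot (i j : 'I_n) : R := ln `|dot (u i) (u j)|.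

Definition energy (p : 'rV[R]_n) : R :=
  \sum_i \sum_j p 0 i * p 0 j * log_dot i j.

(** The product telescopes: each matrix multiplication produces one inner
    product of neighbouring letters. *)
Lemma word_prod_rank1 (i : 'I_n) (s : seq 'I_n) :
  \big[mulmx/1%:M]_(j <- rev (i :: s)) (u j *m (u j)^T) =
  (\prod_(c < size s) dot (u (nth i (i :: s) c.+1)) (u (nth i (i :: s) c))) *:
    (u (last i s) *m (u i)^T).
Proof.
elim/last_ind: s => [|s j IHs]; first by rewrite big_ord0 scale1r big_cons big_nil mulmx1.
rewrite -rcons_cons rev_rcons big_cons IHs -scalemxAr mul_rank1 scalerA last_rcons.
congr (_ *: _); rewrite size_rcons big_ord_recr /=; congr (_ * _).
  apply: eq_bigr => c _; rewrite -rcons_cons !nth_rcons /= ltn_ord.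
  by rewrite ltnS (ltnW (ltn_ord c)).
rewrite nth_rcons ltnn eqxx -rcons_cons nth_rcons /= ltnS leqnn.
by rewrite -[nth i (i :: s) _]/(nth i (i :: s) (size (i :: s)).-1) nth_last.
Qed.

Lemma rank1_norm_gt0 i j : 0 < `|u j *m (u i)^T|.
Proof.
rewrite normr_gt0; apply/eqP => uu0.
have : (u j)^T *m (u j *m (u i)^T) *m u i = (dot (u j) (u j) * dot (u i) (u i))%:M.
  rewrite mulmxA -mulmxA scalar_mxM; congr (_ *m _); apply/matrixP=> x y;
    rewrite !ord1 !mxE eqxx mulr1n; apply: eq_bigr => k _; rewrite !mxE //.
rewrite uu0 mulmx0 mul0mx !norm2_1 // mulr1 => /matrixP/(_ 0 0).
by rewrite !mxE eqxx => /eqP; rewrite eq_sym oner_eq0.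
Qed.

Lemma ln_norm_word_prod (k : nat) (w : {ffun 'I_k.+1 -> 'I_n}) :
  lne (`|word_prod (fun i => u i *m (u i)^T) [tuple w c | c < k.+1]|%:E) =
  (\sum_(c < k) log_dot (w (lift ord0 c)) (w (widen_ord (leqnSn k) c))
     + ln `|u (w ord_max) *m (u (w ord0))^T|)%:E.
Proof.
have nthE (c : 'I_k.+1) : nth (w ord0) [tuple w c | c < k.+1] c = w c.
  by rewrite -tnth_nth tnth_mktuple.
set t := [tuple w c | c < k.+1] in nthE *.
have tE : t = w ord0 :: behead t :> seq 'I_n.
  by rewrite (congr1 val (tuple_eta t)) /= /thead tnth_mktuple.
have sz : size (behead t) = k by rewrite size_behead size_tuple.
rewrite /word_prod tE word_prod_rank1 -tE sz normrZ.
have -> : last (w ord0) (behead t) = w ord_max.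
  by rewrite -[LHS]/(last (w ord0) (w ord0 :: behead t)) -tE -nth_last size_tuple -(nthE ord_max).
have prodE : `|\prod_(c < k) dot (u (nth (w ord0) t c.+1)) (u (nth (w ord0) t c))| =
    expR (\sum_(c < k) log_dot (w (lift ord0 c)) (w (widen_ord (leqnSn k) c))).
  rewrite expR_sum normr_prod; apply: eq_bigr => c _.
  rewrite /log_dot lnK ?posrE ?normr_gt0 //.
  by rewrite (nthE (widen_ord (leqnSn k) c)) (nthE (lift ord0 c)).
rewrite prodE lne_EFin ?mulr_gt0 ?expR_gt0 ?rank1_norm_gt0 //.
by rewrite lnM ?posrE ?expR_gt0 ?rank1_norm_gt0 // expRK.
Qed.

Lemma tuple_sum_ffun (k : nat) (F : k.-tuple 'I_n -> \bar R) :
  (\sum_w F w = \sum_(w : {ffun 'I_k -> 'I_n}) F [tuple w c | c < k])%E.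
Proof.
rewrite (reindex (fun w : {ffun 'I_k -> 'I_n} => [tuple w c | c < k])) //.
exists (fun t : k.-tuple 'I_n => [ffun c => tnth t c]) => [w|t] _.
  by apply/ffunP=> c; rewrite ffunE tnth_mktuple.
by apply: eq_from_tnth => c; rewrite tnth_mktuple ffunE.
Qed.

(** The error [e] is the mean of the contribution of the two end letters; it is
    bounded uniformly in the length because there are finitely many pairs. *)
Lemma expected_log_norm_rank1 (p : 'rV[R]_n) (k : nat) : simplex p ->
  exists2 e : R, `|e| <= \sum_i \sum_j `|ln `|u j *m (u i)^T| | &
  expected_log_norm (fun i => u i *m (u i)^T) p k.+1 = (k%:R * energy p + e)%:E.
Proof.
move=> [p_ge0 p_sum]; rewrite /expected_log_norm tuple_sum_ffun.
have weightE (w : {ffun 'I_k.+1 -> 'I_n}) :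
    \prod_(i <- [tuple w c | c < k.+1]) p 0 i = \prod_c p 0 (w c).
  by rewrite big_tuple; apply: eq_bigr => c _; rewrite tnth_mktuple.
pose e := \sum_(w : {ffun 'I_k.+1 -> 'I_n}) (\prod_c p 0 (w c)) *
  ln `|u (w ord_max) *m (u (w ord0))^T|.
exists e.
  set C := \sum_i _; apply: le_trans (ler_norm_sum _ _ _) _.
  have -> : C = \sum_(w : {ffun 'I_k.+1 -> 'I_n}) (\prod_c p 0 (w c)) * C.
    by rewrite -mulr_suml (word_weight_sum k.+1 p_sum) mul1r.
  apply: ler_sum => w _.
  have w_ge0 : 0 <= \prod_c p 0 (w c) by apply: prodr_ge0 => c _.
  rewrite normrM (ger0_norm w_ge0). rewrite ler_wpM2l // /C (bigD1 (w ord0)) //= (bigD1 (w ord_max)) //=.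
  by rewrite -addrA lerDl addr_ge0 // sumr_ge0 // => i _; rewrite ?sumr_ge0.
under eq_bigr => w _ do rewrite weightE ln_norm_word_prod -EFinM mulrDr.
rewrite sumEFin big_split /= -/e; congr ((_ + _)%:E).
under eq_bigr => w _ do rewrite mulr_sumr.
rewrite exchange_big /= (eq_bigr (fun=> energy p)) => [|c _].
  by rewrite sumr_const card_ord mulr_natl.
rewrite (word_expectation_pair p_sum log_dot) //.
by rewrite -val_eqE /= /bump /= add1n gtn_eqF.
Qed.

(** Every pair of consecutive letters has mean [energy p], and the contribution
    of the end letters is bounded, hence negligible after division by the length. *)
Lemma lyapunov_rank1 (p : 'rV[R]_n) : simplex p ->
  lyapunov (fun i => u i *m (u i)^T) p = (energy p)%:E.
Proof.
move=> p_simplex; rewrite /lyapunov.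
apply/cvg_lim; first exact: ereal_hausdorff.
rewrite -cvg_shiftS.
pose C := \sum_i \sum_j `|ln `|u j *m (u i)^T| |.
have val k : exists2 e : R, `|e| <= C &
    ((k.+1%:R^-1)%:E * expected_log_norm (fun i => u i *m (u i)^T) p k.+1)%E =
    (k.+1%:R^-1 * (k%:R * energy p + e))%:E.
  by have [e eC ->] := expected_log_norm_rank1 k p_simplex; exists e.
apply: cvg_EFin; first by apply: nearW => k /=; have [e _ ->] := val k.
pose K := C + `|energy p|.
have harm : (fun k => K * harmonic k) @ \oo --> (0 : R).
  by rewrite -[X in _ --> X](mulr0 K); apply: cvgMl_tmp; apply: cvg_harmonic.
apply: (@squeeze_cvgr _ _ _ _ (fun k => energy p - K * harmonic k)
          (fun k => energy p + K * harmonic k)).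
- apply: nearW => k /=; have [e eC ->] := val k.
  rewrite /harmonic /= -ler_distl.
  have -> : k.+1%:R^-1 * (k%:R * energy p + e) - energy p =
      (e - energy p) / k.+1%:R.
    by rewrite -natr1; field; rewrite natr1 pnatr_eq0.
  rewrite normrM [X in _ * X]ger0_norm ?invr_ge0 // ler_wpM2r ?invr_ge0 //.
  by apply: le_trans (ler_normB _ _) _; rewrite lerD2r.
- by rewrite -[X in _ --> X]subr0; apply: cvgB => //; apply: cvg_cst.
- by rewrite -[X in _ --> X]addr0; apply: cvgD => //; apply: cvg_cst.
Qed.

End RankOne.

(** * Minimising the energy over the simplex *)

Section Minimisation.
Variables (R : realType) (n d : nat) (u : 'I_n -> 'cV[R]_d).
Hypothesis unit_u : forall i, norm2 (u i) = 1.

Lemma simplex_compact : compact (@simplex R n).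
Proof.
apply: (@subclosed_compact _ _ [set v : 'rV[R]_n | forall i, `[0, 1]%classic (v ord0 i)]).
- have -> : @simplex R n =
      (\bigcap_(i in [set: 'I_n]) ((fun v : 'rV[R]_n => v 0 i) @^-1` [set x | 0 <= x]))
      `&` ((fun v : 'rV[R]_n => \sum_(i < n) v 0 i) @^-1` [set 1]).
    by apply/seteqP; split=> [v [v0 v1]|v [v0 v1]]; split=> // i; [move=> _|]; apply: v0.
  apply: closedI.
    apply: closed_bigI => i _; apply: (continuous_closedP _).1; last exact: closed_ge.
    exact: coord_continuous.
  apply: (continuous_closedP _).1; last exact: closed_eq.
  apply: continuous_big; first exact: add_continuous.
  by move=> i _; apply: coord_continuous.
- apply: (@rV_compact R n (fun=> `[0 : R, 1]%classic)) => i.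
  exact: segment_compact.
- move=> v [v0 v1] i; rewrite /= in_itv /= v0 /= -v1 (bigD1 i) //= lerDl.
  by apply: sumr_ge0 => j _; apply: v0.
Qed.

Lemma energy_continuous : continuous (@energy R n d u).
Proof.
apply: continuous_big; first exact: add_continuous.
move=> i _; apply: continuous_big; first exact: add_continuous.
move=> j _ p.
apply: (@continuousM R 'rV[R]_n (fun q => q 0 i * q 0 j) (fun=> log_dot u i j)).
  apply: (@continuousM R 'rV[R]_n (fun q => q 0 i) (fun q => q 0 j));
  exact: coord_continuous.
exact: cst_continuous.
Qed.

Lemma simplex_nonempty : (0 < n)%N -> @simplex R n !=set0.
Proof.
move=> n_gt0; pose i := Ordinal n_gt0; exists (\row_j (j == i)%:R); split=> [j|].
  by rewrite mxE.
rewrite (bigD1 i) //= mxE eqxx big1 ?addr0 // => j ji.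
by rewrite mxE (negbTE ji).
Qed.

Lemma energy_minimum : (0 < n)%N ->
  exists2 p, @simplex R n p & forall q, @simplex R n q -> energy u p <= energy u q.
Proof.
move=> n_gt0.
have [p pS p_min] := EVT_min_rV (simplex_nonempty n_gt0) simplex_compact
  (continuous_subspaceT energy_continuous).
by exists p => [|q qS]; [rewrite inE in pS|apply: p_min; rewrite inE].
Qed.

Variable gamma : R.
Hypothesis gamma_gt0 : 0 < gamma.
Hypothesis gamma_dot : forall i j, gamma <= `|dot (u i) (u j)|.

Lemma log_dot_ge i j : ln gamma <= log_dot u i j.
Proof. by rewrite ler_ln ?posrE // (lt_le_trans gamma_gt0). Qed.

Lemma log_dot_diag i : log_dot u i i = 0.
Proof. by rewrite /log_dot norm2_1 // normr1 ln1. Qed.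

Lemma energy_ge p : @simplex R n p -> ln gamma <= energy u p.
Proof.
move=> [p0 p1].
have -> : ln gamma = \sum_i \sum_j p 0 i * p 0 j * ln gamma.
  rewrite -[LHS]mul1r -{1}p1 mulr_suml; apply: eq_bigr => i _.
  by rewrite -[in LHS](mulr1 (p 0 i)) -{1}p1 mulr_sumr mulr_suml.
apply: ler_sum => i _; apply: ler_sum => j _.
by rewrite ler_wpM2l ?mulr_ge0 // log_dot_ge.
Qed.

Section Frequencies.
Variable k : nat.
Hypothesis k_gt0 : (0 < k)%N.
Implicit Types w : {ffun 'I_k -> 'I_n}.

Definition word_energy w : R := \sum_(a < k) \sum_(b < k) log_dot u (w a) (w b).

Definition frequencies w : 'rV[R]_n :=
  \row_i ((\sum_(a < k) (w a == i))%N%:R / k%:R).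

Lemma sum_frequencies w (F : 'I_n -> R) :
  \sum_i frequencies w 0 i * F i = k%:R^-1 * \sum_(a < k) F (w a).
Proof.
under eq_bigr => i _ do rewrite mxE natr_sum mulrAC mulrC mulr_suml.
rewrite -mulr_sumr exchange_big /=; congr (_ * _); apply: eq_bigr => a _.
rewrite (bigD1 (w a)) //= eqxx mul1r big1 ?addr0 // => i ia.
by rewrite eq_sym (negbTE ia) mul0r.
Qed.

Lemma frequencies_simplex w : simplex (frequencies w).
Proof.
split=> [i|]; first by rewrite mxE divr_ge0.
under eq_bigr => i _ do rewrite -[frequencies w 0 i]mulr1.
by rewrite sum_frequencies sumr_const card_ord mulVf // pnatr_eq0 -lt0n.
Qed.

Lemma energy_frequencies w : energy u (frequencies w) = word_energy w / k%:R ^+ 2.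
Proof.
rewrite /energy.
have inner i : \sum_j frequencies w 0 i * frequencies w 0 j * log_dot u i j =
    frequencies w 0 i * (k%:R^-1 * \sum_(b < k) log_dot u i (w b)).
  rewrite -(sum_frequencies w (log_dot u i)) mulr_sumr.
  by apply: eq_bigr => j _; rewrite mulrA.
under eq_bigr => i _ do rewrite inner.
rewrite sum_frequencies -mulr_sumr /word_energy mulrA -invfM -expr2.
exact: mulrC.
Qed.

(** Pairs of equal positions carry no energy, since [u i] has norm [1]; the other
    [k * (k - 1)] pairs are pairs of independent letters. *)
Lemma mean_word_energy p : @simplex R n p ->
  \sum_(w : {ffun 'I_k -> 'I_n}) (\prod_c p 0 (w c)) * word_energy w =
  k%:R * (k%:R - 1) * energy u p.
Proof.
move=> [p0 p1]; rewrite /word_energy.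
under eq_bigr => w _ do rewrite mulr_sumr.
rewrite exchange_big /= (eq_bigr (fun=> (k%:R - 1) * energy u p)) => [|a _].
  by rewrite sumr_const card_ord -mulrA mulr_natl.
under eq_bigr => w _ do rewrite mulr_sumr.
rewrite exchange_big /= (bigD1 a) //= big1 ?add0r => [|w _]; last first.
  by rewrite log_dot_diag mulr0.
rewrite (eq_bigr (fun=> energy u p)) => [|b ba].
  have : \sum_(b < k) energy u p = k%:R * energy u p.
    by rewrite sumr_const card_ord mulr_natl.
  by rewrite (bigD1 a) //= mulrBl mul1r => <-; rewrite addrC addrK.
by rewrite (word_expectation_pair p1 (log_dot u)) // eq_sym.
Qed.

(** A minimum is at most the mean over random words with independent letters of
    law [p], which is [energy p] up to the missing diagonal pairs. *)
Lemma energy_best_word w p : (forall v, word_energy w <= word_energy v) ->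
  @simplex R n p ->
  energy u (frequencies w) <= energy u p + k%:R^-1 * ln (1 / gamma).
Proof.
move=> w_min pS; have [p0 p1] := pS.
have kR : 0 < k%:R :> R by rewrite ltr0n.
have le_mean : word_energy w <= k%:R * (k%:R - 1) * energy u p.
  have -> : word_energy w =
      \sum_(v : {ffun 'I_k -> 'I_n}) (\prod_c p 0 (v c)) * word_energy w.
    by rewrite -mulr_suml (word_weight_sum k p1) mul1r.
  rewrite -mean_word_energy //; apply: ler_sum => v _.
  by rewrite ler_wpM2l // prodr_ge0.
have e_ge := energy_ge pS.
rewrite energy_frequencies ler_pdivrMr ?exprn_gt0 //.
apply: le_trans le_mean _.
have -> : (energy u p + k%:R^-1 * ln (1 / gamma)) * k%:R ^+ 2 =
    k%:R * (k%:R * energy u p + ln (1 / gamma)).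
  by field; rewrite gt_eqF.
rewrite -mulrA ler_pM2l // mulrBl mul1r lerD2l div1r lnV ?posrE //.
by rewrite lerN2.
Qed.

End Frequencies.
End Minimisation.

Section Traces.
Variables (R : realType) (n d : nat) (A : 'I_n -> 'M[rat]_d) (u : 'I_n -> 'cV[R]_d).
Hypothesis rank1 : forall i, map_mx ratr (A i) = u i *m (u i)^T.

Lemma ratr_trace_mul i j : ratr (trace_mul A i j) = dot (u i) (u j) ^+ 2 :> R.
Proof.
have entryE l r s : ratr (A l r s) = u l r 0 * u l s 0 :> R.
  have := congr1 (fun M : 'M[R]_d => M r s) (rank1 l).
  by rewrite !mxE big_ord1 !mxE.
rewrite rmorph_sum expr2 /dot mulr_suml /=; apply: eq_bigr => r _.
rewrite rmorph_sum mulr_sumr /=; apply: eq_bigr => s _.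
by rewrite rmorphM /= !entryE; ring.
Qed.

Lemma trace_mul_diag i : norm2 (u i) = 1 -> trace_mul A i i = 1.
Proof.
move=> u1; have : ratr (trace_mul A i i) = ratr 1 :> R.
  by rewrite ratr_trace_mul norm2_1 // expr1n rmorph1.
exact: fmorph_inj.
Qed.

(** The exact rational value compared by the program is an increasing function of
    the energy; the factor [2] comes from the squared inner products. *)
Lemma ratr_prod_trace_mul k (w : {ffun 'I_k -> 'I_n}) :
  (forall i j, dot (u i) (u j) != 0) ->
  ratr (\prod_(a < k) \prod_(b < k) trace_mul A (w a) (w b)) =
  expR (2 * word_energy u w).
Proof.
move=> dot_neq0; rewrite mulr_sumr expR_sum rmorph_prod; apply: eq_bigr => a _.
rewrite mulr_sumr expR_sum rmorph_prod; apply: eq_bigr => b _ /=.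
rewrite ratr_trace_mul mulr2n mulrDl mul1r expRD /log_dot.
by rewrite lnK ?posrE ?normr_gt0 // -expr2 -normrX ger0_norm // sqr_ge0.
Qed.

End Traces.

Theorem theorem4p5 (R : realType) (delta gamma : R)
    (delta_gt0 : 0 < delta) (gamma_gt0 : 0 < gamma) :
  exists (algorithm : prog) (P : {poly nat}),
  forall (n d : nat) (A : 'I_n -> 'M[rat]_d) (u : 'I_n -> 'cV[R]_d),
    (0 < n)%N ->
    (forall i, map_mx ratr (A i) = u i *m (u i)^T) ->
    (forall i, norm2 (u i) = 1) ->
    (forall i j, gamma <= `|cos (angle (u i) (u j))|) ->
  exists (t : nat) (m : memory) (phat : 'rV[rat]_n) (mu : \bar R),
    let AR := fun i => map_mx ratr (A i) : 'M[R]_d in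
    let pR := map_mx ratr phat : 'rV[R]_n in
    [/\ exec algorithm (init_mem (encode_input A)) t m,
        (t <= P.[n + bit_complexity A])%N,
        outputs m phat /\ simplex pR,
        is_minimum [set lyapunov AR p | p in @simplex R n] mu
      & (lyapunov AR pR <= mu + (delta * ln (1 / gamma))%:E)%E].
Proof.
(* The least integer above [1 / delta], so that the loss [1 / k] is below [delta]. *)
pose k := (Num.trunc delta^-1).+1.
have k_gt0 : (0 < k)%N by [].
have k_delta : k%:R^-1 <= delta.
  by rewrite -[leRHS]invrK lef_pV2 ?posrE ?invr_gt0 ?ltr0n // ltW // truncnS_gt.
exists (best_word_program k), (time_bound (best_word_program k) \Po length_bound k).
move=> n d A u n_gt0 rank1 unit_u gamma_cos.
have gamma_dot i j : gamma <= `|dot (u i) (u j)| by rewrite -cos_angle.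
have dot_neq0 i j : dot (u i) (u j) != 0.
  by rewrite -normr_gt0 (lt_le_trans gamma_gt0).
have tr1 i : trace_mul A i i = 1 by apply: (trace_mul_diag rank1).
have [t [m [w [ex tP w_best freq]]]] := best_word_algorithm k n_gt0 tr1.
have w_min (v : {ffun 'I_k -> 'I_n}) : word_energy u w <= word_energy u v.
  have := w_best v; rewrite -(ler_rat R) !(ratr_prod_trace_mul rank1) //.
  by rewrite ler_expR ler_pM2l.
pose phat : 'rV[rat]_n := \row_i ((\sum_(a < k) (w a == i))%N%:R / k%:R).
have [p pS p_min] := energy_minimum u n_gt0.
exists t, m, phat, (energy u p)%:E => AR pR.
have pRE : pR = frequencies R w.
  by apply/rowP=> i; rewrite !mxE fmorph_div /= !ratr_nat.
have ARE : AR = fun i => u i *m (u i)^T by apply: funext => i; apply: rank1.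
have lyap q : simplex q -> lyapunov AR q = (energy u q)%:E.
  by move=> qS; rewrite ARE lyapunov_rank1.
have pR_simplex : simplex pR by rewrite pRE; apply: frequencies_simplex.
split=> //.
- split=> // i; have [-> ->] := freq i; split; first by rewrite ltz_nat.
  by rewrite mxE.
- split; first by exists p => //; apply: lyap.
  by move=> _ [q qS <-]; rewrite lyap // lee_fin p_min.
rewrite lyap // -EFinD lee_fin pRE.
apply: le_trans (energy_best_word unit_u gamma_gt0 gamma_dot k_gt0 w_min pS) _.
rewrite lerD2l ler_wpM2r // ln_ge0 // div1r.
pose i0 := Ordinal n_gt0.
rewrite invf_ge1 //; apply: le_trans (gamma_dot i0 i0) _.
by rewrite dot_norm_le1.
Qed.
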